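(* Let $H_n=((x_1,y_1),\dots,(x_n,y_n))$ be generated by the adaptive linear Gaussian sampling procedure (described in the context) with a fixed sampling rule $\Lambda$, known variance $\sigma^2>0$, and true coefficient vector $\beta_0\in\mathbb{R}^p$. Let $\pi$ be a prior density for $\beta$ and $\pi(\beta\mid H_n)$ the corresponding posterior. Let $\hat\beta_n=(\mathbf{X}_n^\top\mathbf{X}_n)^{-1}\mathbf{X}_n^\top\mathbf{y}_n$ (defined whenever $\mathbf{X}_n^\top\mathbf{X}_n$ is invertible). Assume: (i) $\lambda_{\min}(\mathbf{X}_n^\top\mathbf{X}_n)\xrightarrow{p}\infty$ and $\log\lambda_{\max}(\mathbf{X}_n^\top\mathbf{X}_n)=o_p\big(\lambda_{\min}(\mathbf{X}_n^\top\mathbf{X}_n)\big)$; (ii) $\pi$ is continuous with $\pi(\beta_0)>0$. Then $$\big\|\pi(\cdot\mid H_n)-\mathcal{N}\big(\hat\beta_n,\sigma^2(\mathbf{X}_n^\top\mathbf{X}_n)^{-1}\big)\big\|_{\mathrm{TV}}\xrightarrow{p}0,$$ where convergence in probability is under the data-generating distribution with parameter $\beta_0$.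
   Context: Adaptive linear Gaussian sampling procedure: given a covariate sampling rule $\Lambda$ that maps any finite history $H_{j-1}=((x_1,y_1),\dots,(x_{j-1},y_{j-1}))\in(\mathbb{R}^p\times\mathbb{R})^{j-1}$ to a probability distribution $\Lambda(\cdot\mid H_{j-1})$ on $\mathbb{R}^p$, a coefficient vector $\beta\in\mathbb{R}^p$ and a known variance $\sigma^2>0$, set $H_0=\emptyset$ and for $j=1,\dots,n$: draw $x_j\sim\Lambda(\cdot\mid H_{j-1})$, then draw $y_j\sim\mathcal{N}(x_j^\top\beta,\sigma^2)$ (conditionally on the past and $x_j$), and set $H_j=((x_1,y_1),\dots,(x_j,y_j))$. $\mathbf{X}_n$ is the $n\times p$ matrix with $j$-th row $x_j^\top$ and $\mathbf{y}_n$ the vector with $j$-th entry $y_j$. The posterior is $\pi(\beta\mid H_n)\propto\pi(\beta)\prod_{j=1}^n\exp\!\big(-(y_j-x_j^\top\beta)^2/(2\sigma^2)\big)$. $\lambda_{\min},\lambda_{\max}$ denote the smallest and largest eigenvalues; $\|\cdot\|_{\mathrm{TV}}$ is total variation distance between probability distributions. *)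

(* Defs.v *)
From HB Require Import structures.
From mathcomp Require Import all_boot all_order all_algebra.
From mathcomp Require Import all_classical all_reals all_analysis.
Set Implicit Arguments.
Unset Strict Implicit.
Unset Printing Implicit Defensive.
Import Order.TTheory GRing.Theory Num.Theory.
Import numFieldNormedType.Exports.
Local Open Scope classical_set_scope.
Local Open Scope ring_scope.

Section defs.
Variables (R : realType) (p : nat).

(** A covariate x is a p.-tuple R (the measurable space R^p with the product
    Borel sigma-algebra, mathcomp-analysis' tuple instance); one observation is
    a pair (x, y), a history of length n is an n.-tuple of observations. *)
Definition obs := (p.-tuple R * R)%type.
Definition hist (n : nat) := n.-tuple obs.

Definition col_of (t : p.-tuple R) : 'cV[R]_p := \col_(i < p) tnth t i.

Definition Xmat n (h : hist n) : 'M[R]_(n, p) :=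
  \matrix_(i < n, k < p) tnth (tnth h i).1 k.
Definition yvec n (h : hist n) : 'cV[R]_n := \col_(i < n) (tnth h i).2.
Definition gram n (h : hist n) : 'M[R]_p := (Xmat h)^T *m Xmat h.

Definition betahat n (h : hist n) : 'cV[R]_p :=
  invmx (gram h) *m ((Xmat h)^T *m yvec h).

Definition lambda_min (A : 'M[R]_p) : R := inf [set a : R | eigenvalue A a].
Definition lambda_max (A : 'M[R]_p) : R := sup [set a : R | eigenvalue A a].

(** Lebesgue integral over R^p of a nonnegative function, as the iterated
    one-dimensional Lebesgue integral (Tonelli). *)
Fixpoint iint (k : nat) : (k.-tuple R -> \bar R) -> \bar R :=
  match k with
  | 0 => fun f => f [tuple]
  | k'.+1 => fun f =>
      (\int[@lebesgue_measure R]_t iint (fun v : k'.-tuple R => f (cons_tuple t v)))%E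
  end.

Definition lebRp (f : 'cV[R]_p -> \bar R) : \bar R := iint (fun t => f (col_of t)).

Definition TV (f g : 'cV[R]_p -> R) : \bar R :=
  ereal_sup [set e | exists2 A : set (p.-tuple R), measurable A &
     e = `| iint (fun t => ((\1_A t) * f (col_of t))%:E)
          - iint (fun t => ((\1_A t) * g (col_of t))%:E) |%E ].

Definition lik (sigma : R) n (h : hist n) (beta : 'cV[R]_p) : R :=
  \prod_(i < n)
    expR (- ((tnth h i).2 - ((col_of (tnth h i).1)^T *m beta) 0 0) ^+ 2
           / (sigma ^+ 2 *+ 2)).

Definition posterior (prior : 'cV[R]_p -> R) (sigma : R) n (h : hist n)
    (beta : 'cV[R]_p) : R :=
  prior beta * lik sigma h beta
  / fine (lebRp (fun b => (prior b * lik sigma h b)%:E)).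

Definition gauss_density (mu : 'cV[R]_p) (sigma : R) (G : 'M[R]_p)
    (beta : 'cV[R]_p) : R :=
  (Num.sqrt (pi *+ 2)) ^- p * (Num.sqrt (\det (sigma ^+ 2 *: invmx G)))^-1
  * expR (- (((beta - mu)^T *m G *m (beta - mu)) 0 0) / (sigma ^+ 2 *+ 2)).

Definition history (Omega : Type) (X : nat -> Omega -> p.-tuple R)
  (Y : nat -> Omega -> R) n (w : Omega) : hist n :=
  [tuple (X i w, Y i w) | i < n].

End defs.

(* Main.v *)
Require Import Defs.
From HB Require Import structures.
From mathcomp Require Import all_boot all_order all_algebra.
From mathcomp Require Import all_classical all_reals all_analysis.
From mathcomp Require Import measurable_realfun.
From mathcomp Require Import ring lra.
Import Order.TTheory GRing.Theory Num.Theory.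
Import numFieldNormedType.Exports.
Local Open Scope classical_set_scope.
Local Open Scope ring_scope.
Set Implicit Arguments.
Unset Strict Implicit.
Unset Printing Implicit Defensive.

(** Completing the square, the likelihood is a constant times the density g of
    N(betahat, sigma^2 V^-1) with V the Gram matrix, so that the posterior is
    prior * g / Z with Z the integral of prior * g.  If betahat is close to
    beta0, then g is at most eta (using ln lambda_max = o(lambda_min)) and has
    mass at most eta outside a small ball around beta0, while the prior is
    within eta of prior beta0 inside.  Hence Z <= prior beta0 + 2 eta, and
    integrating the positive part of g - prior * g / Z bounds the total
    variation distance by 3 eta / prior beta0 + eta.

    That betahat is close to beta0 follows by the method of mixtures.  Each
    likelihood ratio lik b / lik beta0 has mean 1 under beta0, hence so has
    its average over b ~ N(beta0, sigma^2 I), which is at least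
    det (V + I)^(-1/2) exp (u^T V u / (4 sigma^2)) for u = betahat - beta0 and
    lambda_min >= 1.  By Markov's inequality u^T V u = O_p (1 + ln lambda_max),
    and u^T V u >= lambda_min |u|^2.

    The values of a measure on non-measurable sets are unconstrained, so all
    events involved have to be proved measurable. *)

(** * Quadratic forms and extreme eigenvalues *)

(** The covariates depend on earlier responses, so the noise is not Gaussian given the design and
    the usual variance computation for [betahat] breaks down. The likelihood ratio is insensitive to
    this: whatever [Lambda] is, each step multiplies it by a factor of conditional mean 1, so one
    Markov inequality at time n suffices. The price is det (V + I)^(1/2), whose logarithm is of
    order ln lambda_max; hypothesis (i) makes it negligible against lambda_min. The same hypothesis
    is used once more against the peak height of g, which grows like det (V)^(1/2). An upper bound
    on Z is enough because, between probability densities, the total variation distance is the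
    integral of the positive part of either difference. Away from beta0 two estimates are needed:
    the prior may be unbounded there, so prior * g is bounded by the supremum of g times the prior
    mass, whereas the mass of g is compared with that of a wider Gaussian. *)

Section bilinear_forms.
Context {R : realType}.

Definition bform n (A : 'M[R]_n) (u v : 'cV[R]_n) : R := (u^T *m A *m v) 0 0.
Definition qform n (A : 'M[R]_n) (v : 'cV[R]_n) : R := bform A v v.

Section fixed_size.
Variable n : nat.
Implicit Types (A B : 'M[R]_n) (u v w : 'cV[R]_n).

Lemma bformDl A u v w : bform A (u + v) w = bform A u w + bform A v w.
Proof. by rewrite /bform linearD /= !mulmxDl mxE. Qed.

Lemma bformDr A u v w : bform A u (v + w) = bform A u v + bform A u w.
Proof. by rewrite /bform mulmxDr mxE. Qed.

Lemma bformZl A c u v : bform A (c *: u) v = c * bform A u v.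
Proof. by rewrite /bform linearZ /= -!scalemxAl mxE. Qed.

Lemma bformZr A c u v : bform A u (c *: v) = c * bform A u v.
Proof. by rewrite /bform -scalemxAr mxE. Qed.

Lemma bformNl A u v : bform A (- u) v = - bform A u v.
Proof. by rewrite -scaleN1r bformZl mulN1r. Qed.

Lemma bformNr A u v : bform A u (- v) = - bform A u v.
Proof. by rewrite -scaleN1r bformZr mulN1r. Qed.

Lemma bformC A u v : A^T = A -> bform A u v = bform A v u.
Proof.
move=> sA; rewrite /bform.
have -> : (u^T *m A *m v) 0 0 = ((u^T *m A *m v)^T) 0 0 by rewrite [RHS]mxE.
by rewrite !trmx_mul trmxK sA mulmxA.
Qed.

Lemma bform_add A B u v : bform (A + B) u v = bform A u v + bform B u v.
Proof. by rewrite /bform mulmxDr mulmxDl mxE. Qed.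

Lemma bform_scale c A u v : bform (c *: A) u v = c * bform A u v.
Proof. by rewrite /bform -scalemxAr -scalemxAl mxE. Qed.

Lemma bform_opp A u v : bform (- A) u v = - bform A u v.
Proof. by rewrite -scaleN1r bform_scale mulN1r. Qed.

Lemma qform0 A : qform A 0 = 0.
Proof. by rewrite /qform /bform mulmx0 mxE. Qed.

Lemma qformN A v : qform A (- v) = qform A v.
Proof. by rewrite /qform bformNl bformNr opprK. Qed.

Lemma qformZ A c v : qform A (c *: v) = c ^+ 2 * qform A v.
Proof. by rewrite /qform bformZl bformZr mulrA expr2. Qed.

Lemma qformD A u v : A^T = A ->
  qform A (u + v) = qform A u + 2 * bform A u v + qform A v.
Proof.
move=> sA; rewrite /qform bformDl !bformDr (bformC v u sA).
ring.
Qed.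

Lemma qform_sum A v : qform A v = \sum_i \sum_j v i 0 * A i j * v j 0.
Proof.
rewrite /qform /bform mxE exchange_big /=; apply: eq_bigr => j _.
by rewrite mxE big_distrl /=; apply: eq_bigr => i _; rewrite mxE.
Qed.

Lemma qform1E v : qform 1%:M v = \sum_i v i 0 ^+ 2.
Proof.
rewrite /qform /bform mulmx1 mxE; apply: eq_bigr => i _.
by rewrite mxE expr2.
Qed.

Lemma qform1_ge0 v : 0 <= qform 1%:M v.
Proof. by rewrite qform1E sumr_ge0 // => i _; rewrite sqr_ge0. Qed.

Lemma qform1_eq0 v : (qform 1%:M v == 0) = (v == 0).
Proof.
apply/idP/eqP => [|->]; last by rewrite qform0.
rewrite qform1E psumr_eq0 => [/allP v0|i _]; last exact: sqr_ge0.
apply/colP => i; have := v0 i (mem_index_enum _).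
by rewrite sqrf_eq0 mxE => /eqP.
Qed.

Lemma qform1_gt0 v : v != 0 -> 0 < qform 1%:M v.
Proof. by move=> v0; rewrite lt_def qform1_eq0 v0 qform1_ge0. Qed.

Lemma sqr_coord_le_qform1 v i : v i 0 ^+ 2 <= qform 1%:M v.
Proof.
rewrite qform1E (bigD1 i) //= lerDl sumr_ge0 // => j _; exact: sqr_ge0.
Qed.

Lemma qform_continuous A : continuous (qform A).
Proof.
have -> : qform A = fun v => \sum_i \sum_j v i 0 * A i j * v j 0.
  by apply/funext => v; rewrite qform_sum.
apply: continuous_big; first exact: add_continuous.
move=> i _; apply: continuous_big; first exact: add_continuous.
move=> j _ v; have cc k := @coord_continuous R n 1 k 0 v.
exact: (continuousM (continuousM (cc i) (@cst_continuous _ _ (A i j) v)) (cc j)).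
Qed.

End fixed_size.
End bilinear_forms.

(** * Variational characterisation of the extreme eigenvalues *)

Section rayleigh.
Context {R : realType}.

(** With w = B v, the form at v + t w equals 2 t |w|^2 + t^2 q(w), which is negative for small t < 0
    unless w = 0. *)
Lemma psd_form_kernel n (B : 'M[R]_n) (v : 'cV[R]_n) : B^T = B ->
  (forall w, 0 <= qform B w) -> qform B v = 0 -> B *m v = 0.
Proof.
move=> sB psdB qv; set w := B *m v.
have bw : bform B v w = qform 1%:M w.
  by rewrite /qform /bform mulmx1 /w trmx_mul sB.
apply/eqP; rewrite -qform1_eq0; set b := qform 1%:M w.
have b0 : 0 <= b by exact: qform1_ge0.
have key t : 0 <= 2 * t * b + t ^+ 2 * qform B w.
  have := psdB (v + t *: w); rewrite qformD // qv bformZr qformZ bw -/b.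
  by rewrite add0r mulrA.
have c0 : 0 <= qform B w := psdB w.
set c := qform B w in key c0.
rewrite eq_le b0 andbT leNgt; apply/negP => bgt0.
(* [c + 1] instead of [c] keeps the denominator positive even if q(w) = 0. *)
have := key (- (b / (c + 1))).
have c1 : 0 < c + 1 by rewrite ltr_wpDl.
have -> : 2 * - (b / (c + 1)) * b + (- (b / (c + 1))) ^+ 2 * c =
  - (b ^+ 2 * ((c + 2) / (c + 1) ^+ 2)) by field; rewrite gt_eqF.
rewrite oppr_ge0 leNgt; apply/negP; rewrite negbK mulr_gt0 ?exprn_gt0 //.
by rewrite divr_gt0 ?exprn_gt0 // ltr_wpDl.
Qed.

(** The unit sphere is compact, so the form attains its minimum there; homogeneity of degree 2
    carries the bound to all w. The sphere consists of row vectors to fit [EVT_min_rV]. *)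
Lemma rayleigh_min_attained n (A : 'M[R]_n) : (0 < n)%N ->
  exists2 v : 'cV[R]_n, qform 1%:M v = 1 &
    forall w, qform A v * qform 1%:M w <= qform A w.
Proof.
move=> n0; pose S := [set v : 'rV[R]_n | qform 1%:M v^T = 1].
have qc (B : 'M[R]_n) : continuous (fun v : 'rV[R]_n => qform B v^T).
  rewrite (_ : (fun v => _) =
    fun v : 'rV[R]_n => \sum_i \sum_j v 0 i * B i j * v 0 j); last first.
    apply/funext => v; rewrite qform_sum.
    by apply: eq_bigr => i _; apply: eq_bigr => j _; rewrite !mxE.
  apply: continuous_big; first exact: add_continuous.
  move=> i _; apply: continuous_big; first exact: add_continuous.
  move=> j _ v; have cc k := @coord_continuous R 1 n 0 k v.
  exact: (continuousM (continuousM (cc i) (@cst_continuous _ _ (B i j) v)) (cc j)).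
have S0 : S !=set0.
  exists (delta_mx 0 (Ordinal n0)); rewrite /S /= trmx_delta qform1E.
  rewrite (bigD1 (Ordinal n0)) //= mxE !eqxx expr1n big1 ?addr0 // => i.
  by move=> /negbTE ni; rewrite mxE ni expr0n.
have cS : compact S.
  apply: bounded_closed_compact.
    exists 1; split => // x x1 v Sv /=.
    rewrite [leLHS]/Num.norm /= mx_normrE; apply: bigmax_le => [|i _].
      exact: le_trans ler01 (ltW x1).
    apply: le_trans (ltW x1); rewrite -(@expr_le1 _ 2) //.
    rewrite real_normK ?num_real // (ord1 i.1).
    have := sqr_coord_le_qform1 v^T i.2; rewrite mxE.
    by move=> /le_trans; apply; rewrite Sv.
  apply: (@preimage_closed _ _ (fun v : 'rV[R]_n => qform 1%:M v^T) [set 1]).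
    by move=> x _; exact: qc.
  exact: closed_eq.
have [|v] := @EVT_min_rV _ _ (fun v => qform A v^T) _ S0 cS.
  by apply: continuous_subspaceT => x; exact: qc.
rewrite inE => Sv minv; exists v^T => // w.
have [->|w0] := eqVneq w 0; first by rewrite !qform0 mulr0.
have q0 := qform1_gt0 w0; set c := Num.sqrt (qform 1%:M w).
have cc : c ^+ 2 = qform 1%:M w by rewrite sqr_sqrtr // ltW.
have := minv ((c^-1 *: w)^T).
have -> : (c^-1 *: w)^T \in S.
  by rewrite inE /S /= trmxK qformZ exprVn cc mulVf // gt_eqF.
by rewrite trmxK qformZ exprVn cc mulrC => /(_ isT); rewrite ler_pdivlMr.
Qed.

(** If a is the minimum of the Rayleigh quotient, then A - a I is positive semidefinite and its form
    vanishes at the minimiser, which is therefore an eigenvector for a. No real eigenvalue is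
    smaller, so a is the infimum that defines [lambda_min]. *)
Lemma lambda_min_spec n (A : 'M[R]_n) : A^T = A -> (0 < n)%N ->
  exists2 v : 'cV[R]_n, v != 0 & qform A v = lambda_min A * qform 1%:M v /\
    forall w, lambda_min A * qform 1%:M w <= qform A w.
Proof.
move=> sA n0; have [v v1 minv] := rayleigh_min_attained A n0.
have v0 : v != 0.
  by rewrite -qform1_eq0 v1 oner_neq0.
set a := qform A v in minv.
have Av : A *m v = a *: v.
  apply/eqP; rewrite -subr_eq0 -mul_scalar_mx -mulmxBl; apply/eqP.
  have qB w : qform (A - a%:M) w = qform A w - a * qform 1%:M w.
    by rewrite /qform bform_add bform_opp -(scalemx1 _ a) bform_scale.
  apply: psd_form_kernel => [|w|].
  - by rewrite linearB /= tr_scalar_mx sA.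
  - by rewrite qB subr_ge0.
  - by rewrite qB v1 mulr1 subrr.
have aA : eigenvalue A a.
  apply/eigenvalueP; exists v^T; last by rewrite trmx_eq0.
  by rewrite -[A]sA -trmx_mul Av linearZ.
have lbA : lbound [set b | eigenvalue A b] a.
  move=> b /= /eigenvalueP[w Aw w0].
  have := minv w^T; rewrite {2}/qform /bform trmxK Aw -scalemxAl mxE.
  have -> : (w *m w^T) 0 0 = qform 1%:M w^T by rewrite /qform /bform trmxK mulmx1.
  by rewrite ler_pM2r // qform1_gt0 // trmx_eq0.
have lA : lambda_min A = a.
  apply/eqP; rewrite eq_le; apply/andP; split.
    by apply: ge_inf => //; exists a.
  by apply: lb_le_inf => //; exists a.
by exists v => //; split; rewrite lA // v1 mulr1.
Qed.

Lemma lambda_maxE n (A : 'M[R]_n) : lambda_max A = - lambda_min (- A).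
Proof.
rewrite /lambda_max /lambda_min /inf opprK; congr sup.
apply/seteqP; split => [a /eigenvalueP[v Av v0]|_ [a /eigenvalueP[v Av v0] <-]] /=.
  exists (- a); rewrite ?opprK //; apply/eigenvalueP; exists v => //.
  by rewrite mulmxN Av scaleNr.
by apply/eigenvalueP; exists v => //; rewrite scaleNr -Av mulmxN opprK.
Qed.

Lemma lambda_min_le n (A : 'M[R]_n) v : A^T = A ->
  lambda_min A * qform 1%:M v <= qform A v.
Proof.
move=> sA; case: (posnP n) => [n0|n0]; last first.
  by have [_ _ [_ ->]] := lambda_min_spec sA n0.
by subst n; rewrite (_ : v = 0) ?qform0 ?mulr0 //; apply/colP => -[].
Qed.

Lemma lambda_max_ge n (A : 'M[R]_n) v : A^T = A ->
  qform A v <= lambda_max A * qform 1%:M v.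
Proof.
move=> sA; rewrite lambda_maxE mulNr lerNr -[- qform A v]bform_opp.
by apply: lambda_min_le; rewrite linearN /= sA.
Qed.

Lemma lambda_min_le_max n (A : 'M[R]_n) : A^T = A -> (0 < n)%N ->
  lambda_min A <= lambda_max A.
Proof.
move=> sA n0; have [v v0 [qv _]] := lambda_min_spec sA n0.
by have := lambda_max_ge v sA; rewrite qv ler_pM2r // qform1_gt0.
Qed.

End rayleigh.

(** * Positive definite matrices, Schur complements and determinants *)

Section positive_definite.
Context {R : realType}.

Definition posdef n (A : 'M[R]_n) : Prop :=
  A^T = A /\ forall v, v != 0 -> 0 < qform A v.

Lemma posdef_qform_ge0 n (A : 'M[R]_n) v : posdef A -> 0 <= qform A v.
Proof.
move=> [_ pA]; have [->|/pA/ltW//] := eqVneq v 0.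
by rewrite qform0.
Qed.

Lemma posdef_unitmx n (A : 'M[R]_n) : posdef A -> A \in unitmx.
Proof.
move=> [sA pA]; rewrite unitmxE unitfE; apply/negP => /det0P[v v0 vA].
have := pA v^T; rewrite trmx_eq0 => /(_ v0).
by rewrite /qform /bform trmxK vA mul0mx mxE ltxx.
Qed.

Lemma qform1_col_mx k (t : R) (v : 'cV[R]_k) :
  qform 1%:M (col_mx t%:M v : 'cV_(1 + k)) = t ^+ 2 + qform 1%:M v.
Proof.
rewrite /qform /bform !mulmx1 tr_col_mx mul_row_col tr_scalar_mx -scalar_mxM.
by rewrite !mxE eqxx mulr1n expr2.
Qed.

(** Completes the square in the first coordinate. The vector e = (1, m) with m = - W^-1 V_21 is
    V-orthogonal to all vectors with first coordinate 0, and the Schur complement s is the value of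
    the form at e. This drives the inductions on the dimension, both for determinants and for
    Gaussian integrals. *)
Lemma schur_complement k (V : 'M[R]_(1 + k)) : posdef V ->
  exists (s : R) (m : 'cV[R]_k),
  [/\ 0 < s, s <= qform V (col_mx 1%:M 0),
      \det V = s * \det (drsubmx V), posdef (drsubmx V) &
      forall t v, qform V (col_mx t%:M v) =
                  s * t ^+ 2 + qform (drsubmx V) (v - t *: m)].
Proof.
move=> pV; have [sV pdV] := pV; set W := drsubmx V.
have qW v : qform V (col_mx 0 v) = qform W v.
  rewrite /qform /bform -{1}(submxK V) tr_col_mx mul_row_block trmx0 !mul0mx.
  by rewrite !add0r mul_row_col mulmx0 add0r.
have pW : posdef W.
  split=> [|v v0]; first by rewrite /W trmx_drsub sV.
  rewrite -qW; apply: pdV; apply: contra_neq v0 => v0.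
  by have := v0; rewrite -(col_mx0 _ 1 k 1) => /eq_col_mx[_ ->].
have Wu := posdef_unitmx pW.
pose m := - (invmx W *m dlsubmx V).
pose e := col_mx (1%:M : 'M[R]_1) m; set s := qform V e.
have Ve : V *m e = col_mx (ulsubmx V + ursubmx V *m m) 0.
  rewrite -{1}(submxK V) /e mul_block_col !mulmx1; congr col_mx.
  by rewrite /m mulmxN mulmxA mulmxV // mul1mx subrr.
have Vs : V *m e = col_mx s%:M 0.
  rewrite Ve; congr col_mx; rewrite [LHS]mx11_scalar; congr (_%:M).
  rewrite /s /qform /bform -mulmxA Ve tr_col_mx mul_row_col mulmx0 addr0.
  by rewrite trmx1 mul1mx.
have cross x : bform V (col_mx 0 x) e = 0.
  by rewrite /bform -mulmxA Vs tr_col_mx mul_row_col mulmx0 trmx0 mul0mx addr0 mxE.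
have decomp t v : qform V (col_mx t%:M v) = s * t ^+ 2 + qform W (v - t *: m).
  have -> : col_mx t%:M v = col_mx 0 (v - t *: m) + t *: e.
    by rewrite /e scale_col_mx add_col_mx add0r scalemx1 subrK.
  by rewrite qformD // bformZr cross !mulr0 addr0 qformZ qW addrC mulrC.
exists s, m; split => //.
- apply: pdV; apply/eqP; rewrite /e -(col_mx0 _ 1 k 1) => /eq_col_mx[/matrixP/(_ 0 0)].
  by rewrite !mxE eqxx => /eqP; rewrite oner_eq0.
- by rewrite decomp expr1n mulr1 lerDl posdef_qform_ge0.
- have := congr1 determinant (_ : V *m block_mx 1%:M 0 m 1%:M =
    block_mx s%:M (ursubmx V) 0 W).
  rewrite det_mulmx det_lblock det_ublock !det1 !mulr1 det_scalar1; apply.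
  rewrite -{1}(submxK V) mulmx_block !mulmx1 !mulmx0 !add0r.
  have := Vs; rewrite -{1}(submxK V) /e mul_block_col !mulmx1.
  by move=> /eq_col_mx[-> ->].
Qed.

Lemma posdef_det_gt0 n (A : 'M[R]_n) : posdef A -> 0 < \det A.
Proof.
elim: n A => [|n IH] A pA; first by rewrite det_mx00.
by have [s [m [s0 _ -> pW _]]] := schur_complement pA; rewrite mulr_gt0 // IH.
Qed.

(** No diagonalisation is involved: the pivot s is at most the top left entry, hence at most L, and
    the lower right block inherits the bound on the form. *)
Lemma posdef_det_le n (A : 'M[R]_n) (L : R) : posdef A ->
  (forall v, qform A v <= L * qform 1%:M v) -> \det A <= L ^+ n.
Proof.
elim: n A => [|n IH] A pA AL; first by rewrite det_mx00.
have [s [m [s0 sa dA pW dec]]] := @schur_complement n A pA.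
have sL : s <= L.
  apply: le_trans sa _; apply: le_trans (AL _) _.
  by rewrite qform1_col_mx qform0 addr0 expr1n mulr1.
rewrite dA exprS; apply: ler_pM => //; [exact: ltW|exact/ltW/posdef_det_gt0|].
apply: IH => // v; have := AL (col_mx (0 : R)%:M v).
rewrite dec expr0n /= mulr0 add0r scale0r subr0 => /le_trans; apply.
rewrite ler_wpM2l ?(le_trans (ltW s0)) // qform1_col_mx.
by rewrite expr0n add0r.
Qed.

End positive_definite.

(** * Iterated integrals as integrals against a measure *)

Section iterated_integral_measure.
Context {R : realType}.
Local Open Scope ereal_scope.

Section sigma_finite_copy.
Context d (T : measurableType d) (mu : {measure set T -> \bar R}).
Hypothesis sf : sigma_finite setT mu.

(** An alias of [mu] indexed by the proof of sigma-finiteness, so that the structure can be attached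
    to it. *)
Definition sigma_finite_copy & sigma_finite setT mu : set T -> \bar R := mu.

HB.instance Definition _ := Measure.copy (sigma_finite_copy sf) mu.
HB.instance Definition _ :=
  Measure_isSigmaFinite.Build _ _ _ (sigma_finite_copy sf) sf.

Lemma sigma_finite_measure_pack :
  exists nu : {sigma_finite_measure set T -> \bar R},
    nu = mu :> (set T -> \bar R).
Proof. by exists (sigma_finite_copy sf). Qed.

End sigma_finite_copy.

Lemma pushforward_pack d d' (T : measurableType d) (U : measurableType d')
    (mu : {measure set T -> \bar R}) (f : T -> U) : measurable_fun setT f ->
  exists nu : {measure set U -> \bar R},
    nu = pushforward mu f :> (set U -> \bar R).
Proof.
move=> mf.
by exists (measure_function_pushforward__canonical__measure_function_Measure mu mf).
Qed.

(** Gives [iint], defined by recursion, access to linearity, monotonicity and Tonelli's theorem. In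
    dimension k + 1 the measure is the image under cons of Lebesgue measure times the previous
    measure; sigma-finiteness is carried along for the next use of Tonelli. *)
Lemma iint_measure k : exists mu : {sigma_finite_measure set (k.-tuple R) -> \bar R},
  forall f : k.-tuple R -> \bar R, (forall x, 0 <= f x) ->
    measurable_fun [set: k.-tuple R] f -> iint f = \int[mu]_x f x.
Proof.
elim: k => [|k [mu IH]].
  exists (dirac [tuple]) => f f0 mf.
  by rewrite integral_dirac //= diracT mul1e.
pose c (z : R * k.-tuple R) : k.+1.-tuple R := cons_tuple z.1 z.2.
have mc : measurable_fun setT c by apply: measurable_cons.
have [nu nuE] := pushforward_pack (@lebesgue_measure R \x mu) mc.
have /sigma_finite_measure_pack[nu' nu'E] : sigma_finite setT nu.
  have /sigma_finiteP[F [F1 F2 F3]] := sigma_finiteT (@lebesgue_measure R).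
  have /sigma_finiteP[G [G1 G2 G3]] := sigma_finiteT mu.
  pose g (v : k.+1.-tuple R) : R * k.-tuple R := (thead v, [tuple of behead v]).
  (* [g] inverts [c], so [c] pulls these sets back to rectangles of finite measure. *)
  exists (fun n => g @^-1` (F n `*` G n)).
    rewrite -preimage_bigcup; apply/esym/seteqP; split => // v _.
    have : setT (g v).1 by []. 
    have : setT (g v).2 by [].
    rewrite {1}G1 {1}F1 => -[n _ Gn] [m _ Fm]; exists (maxn n m) => //; split.
      by have /subsetPset := F2 _ _ (leq_maxr n m); apply.
    by have /subsetPset := G2 _ _ (leq_maxl n m); apply.
  have mg : measurable_fun setT g.
    apply/measurable_fun_pairP; split => /=; last exact: measurable_behead.
    exact: measurable_tnth.
  move=> n; split.
    rewrite -[X in measurable X]setTI; apply: mg => //.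
    by apply: measurableX; [case: (F3 n)|case: (G3 n)].
  rewrite nuE /pushforward (_ : _ @^-1` _ = F n `*` G n); last first.
    rewrite -comp_preimage (_ : g \o c = id) //; apply/funext => -[x v].
    by congr pair; apply/val_inj.
  have [mF lF] := F3 n; have [mG lG] := G3 n.
  by rewrite [ltLHS]product_measure1E // lte_mul_pinfty // ge0_fin_numE.
exists nu' => f f0 mf; rewrite nu'E nuE ge0_integral_pushforward //=.
rewrite preimage_setT fubini_tonelli1 //=; last exact: measurableT_comp.
apply: eq_integral => x _; rewrite IH //.
apply: measurableT_comp => //; exact: measurable_cons.
Qed.

Definition lebtuple k : {sigma_finite_measure set (k.-tuple R) -> \bar R} :=
  projT1 (cid (iint_measure k)).

Lemma iintE k (f : k.-tuple R -> \bar R) : (forall x, 0 <= f x) ->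
  measurable_fun [set: k.-tuple R] f -> iint f = \int[lebtuple k]_x f x.
Proof. exact: (projT2 (cid (iint_measure k))). Qed.

End iterated_integral_measure.

(** * Measurability of likelihoods and eigenvalues *)

Section measurability.
Context {R : realType}.

Lemma measurable_lt_set d (T : measurableType d) (f g : T -> R) :
  measurable_fun setT f -> measurable_fun setT g ->
  measurable [set w | f w < g w].
Proof.
move=> mf mg; rewrite -[X in measurable X]setTI.
exact: (measurable_fun_ltr mf mg measurableT (Y := [set true])).
Qed.

Lemma measurable_le_set d (T : measurableType d) (f g : T -> R) :
  measurable_fun setT f -> measurable_fun setT g ->
  measurable [set w | f w <= g w].
Proof.
move=> mf mg; rewrite -[X in measurable X]setTI.
exact: (measurable_fun_ler mf mg measurableT (Y := [set true])).
Qed.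

Lemma measurable_fun_lt_sets d (T : measurableType d) (f : T -> R) :
  (forall a, measurable [set w | f w < a]) -> measurable_fun setT f.
Proof.
move=> mf; apply: (measurability _ (RGenInftyO.measurableE R)) => //.
move=> _ [_ [a ->] <-]; rewrite setTI.
rewrite (_ : _ @^-1` _ = [set w | f w < a]); first exact: mf.
by apply/seteqP; split => w /=; rewrite in_itv.
Qed.

Lemma rat_col_approx p (v : 'cV[R]_p) (e : R) : 0 < e ->
  exists q : p.-tuple rat, forall i, `|ratr (tnth q i) - v i 0| < e.
Proof.
move=> e0; have h i : {q : rat | `|ratr q - v i 0| < e}.
  apply: cid; have : v i 0 - e < v i 0 + e by lra.
  move=> /rat_in_itvoo[q]; rewrite in_itv /= => /andP[q1 q2].
  by exists q; rewrite ltr_norml; apply/andP; split; lra.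
by exists [tuple projT1 (h i) | i < p] => i; rewrite tnth_mktuple; case: (h i).
Qed.

Lemma open_ratcol p (U : set 'cV[R]_p) (v : 'cV[R]_p) : open U -> U v ->
  exists q : p.-tuple rat, U (\col_i ratr (tnth q i)).
Proof.
rewrite openE => oU /oU /nbhs_ballP[e /= e0 eU].
have [q qv] := rat_col_approx v e0; exists q; apply: eU.
by split=> // i j; rewrite (ord1 j) !mxE /ball /= distrC.
Qed.

(** Links the product sigma-algebra on tuples to the topology on column vectors: an open set is the
    countable union of the rational boxes that it contains. *)
Lemma measurable_preimage_open p (U : set 'cV[R]_p) : open U ->
  measurable (@col_of R p @^-1` U : set (p.-tuple R)).
Proof.
move=> oU.
pose box (z : p.-tuple rat * rat) : set (p.-tuple R) :=
  [set t | forall i, `|ratr (tnth z.1 i) - tnth t i| < ratr z.2].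
pose F z := if `[< box z `<=` @col_of R p @^-1` U >] then box z else set0.
have mbox z : measurable (box z).
  rewrite (_ : box z = \bigcap_(i in [set: 'I_p])
      [set t | `|ratr (tnth z.1 i) - tnth t i| < ratr z.2]).
    apply: fin_bigcap_measurable => // i _.
    apply: measurable_lt_set => //; apply: measurableT_comp => //.
    by apply: measurable_funB => //; exact: measurable_tnth.
  by apply/seteqP; split => [t h i _|t h i]; [exact: h|exact: (h i)].
rewrite (_ : _ @^-1` _ = \bigcup_z F z).
  apply: countable_bigcupT_measurable => [|z]; first exact: countableP.
  by rewrite /F; case: asboolP.
apply/seteqP; split => [t /= Ut|t [z _]]; last first.
  by rewrite /F; case: asboolP => // h /h.
move: oU; rewrite openE => /(_ _ Ut)/nbhs_ballP[e /= e0 eU].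
(* Points of a box of radius r are within 2 r < e of each other; the lower end e / 4 ensures r >
   0. *)
have /rat_in_itvoo[r] : e / 4 < e / 2 by lra.
rewrite in_itv /= => /andP[r1 r2].
have r0 : 0 < ratr r :> R by apply: lt_trans r1; lra.
have [q qv] := rat_col_approx (col_of t) r0.
exists (q, r) => //; rewrite /F; case: asboolP => [_ i|h].
  by have := qv i; rewrite mxE.
exfalso; apply: h => t' /= ht'; apply: eU; split => // i j.
rewrite (ord1 j) /ball /=; have := qv i; have := ht' i; rewrite !mxE /=.
rewrite !ltr_norml => /andP[a1 a2] /andP[b1 b2].
by apply/andP; split; lra.
Qed.

Lemma measurable_continuous_col p (f : 'cV[R]_p -> R) : continuous f ->
  measurable_fun setT (fun t : p.-tuple R => f (col_of t)).
Proof.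
move=> cf; apply: measurable_fun_lt_sets => a.
apply: (@measurable_preimage_open _ [set v | f v < a]).
apply: (@open_comp _ _ f [set x | x < a]); last exact: open_lt.
by move=> v _; exact: cf.
Qed.

Lemma dotE p (u v : p.-tuple R) :
  ((col_of u)^T *m col_of v) 0 0 = \sum_k tnth u k * tnth v k.
Proof. by rewrite mxE; apply: eq_bigr => k _; rewrite !mxE. Qed.

Section with_histories.
Context d (T : measurableType d) (p : nat).

Lemma measurable_dot (f g : T -> p.-tuple R) :
  measurable_fun setT f -> measurable_fun setT g ->
  measurable_fun setT (fun w => ((col_of (f w))^T *m col_of (g w)) 0 0).
Proof.
move=> mf mg; under eq_fun do rewrite dotE.
apply: measurable_sum => k; apply: measurable_funM.
  exact: (measurableT_comp (@measurable_tnth _ _ _ k) mf).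
exact: (measurableT_comp (@measurable_tnth _ _ _ k) mg).
Qed.

Context (n : nat) (H : T -> hist R p n).
Hypothesis mH : measurable_fun setT H.

Lemma measurable_hist_fst i : measurable_fun setT (fun w => (tnth (H w) i).1).
Proof.
apply: (measurableT_comp measurable_fst).
exact: (measurableT_comp (@measurable_tnth _ _ _ i) mH).
Qed.

Lemma measurable_hist_snd i : measurable_fun setT (fun w => (tnth (H w) i).2).
Proof.
apply: (measurableT_comp measurable_snd).
exact: (measurableT_comp (@measurable_tnth _ _ _ i) mH).
Qed.

Lemma measurable_lik (sigma : R) (b : T -> p.-tuple R) :
  measurable_fun setT b ->
  measurable_fun setT (fun w => lik sigma (H w) (col_of (b w))).
Proof.
move=> mb; apply: measurable_prod => i _.
apply: measurableT_comp => //; apply: measurable_funM => //.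
apply: measurableT_comp => //; apply: measurable_funX.
apply: measurable_funB; first exact: measurable_hist_snd.
by apply: measurable_dot => //; exact: measurable_hist_fst.
Qed.

Lemma gram_sym (h : hist R p n) : (gram h)^T = gram h.
Proof. by rewrite /gram trmx_mul trmxK. Qed.

Lemma qform_gram (h : hist R p n) v :
  qform (gram h) v = \sum_i (((col_of (tnth h i).1)^T *m v) 0 0) ^+ 2.
Proof.
rewrite /qform /bform /gram mulmxA -mulmxA -trmx_mul mxE.
apply: eq_bigr => i _; rewrite mxE -expr2; congr (_ ^+ 2).
by rewrite !mxE; apply: eq_bigr => k _; rewrite !mxE.
Qed.

Lemma qform_gram_ge0 (h : hist R p n) v : 0 <= qform (gram h) v.
Proof. by rewrite qform_gram sumr_ge0 // => i _; rewrite sqr_ge0. Qed.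

Lemma gram_posdef (h : hist R p n) : gram h \in unitmx -> posdef (gram h).
Proof.
move=> ug; split=> [|v v0]; first exact: gram_sym.
rewrite lt_def qform_gram_ge0 andbT; apply: contra v0 => /eqP q0.
have := psd_form_kernel (gram_sym h) (qform_gram_ge0 h) q0.
by move/(congr1 (mulmx (invmx (gram h)))); rewrite mulKmx // mulmx0 => ->.
Qed.

Lemma measurable_qform_gram v :
  measurable_fun setT (fun w => qform (gram (H w)) v).
Proof.
have -> : v = col_of [tuple v i 0 | i < p].
  by apply/colP => i; rewrite mxE tnth_mktuple.
under eq_fun do rewrite qform_gram.
apply: measurable_sum => i; apply: measurable_funX.
by apply: measurable_dot => //; exact: measurable_hist_fst.
Qed.

Hypothesis p0 : (0 < p)%N.

(** The strict inequality is an open condition on the vector, so a rational vector witnesses it. The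
    event lambda_min < a becomes a countable union of events about fixed vectors. *)
Lemma lambda_min_ltP (A : 'M[R]_p) (a : R) : A^T = A ->
  lambda_min A < a <-> exists q : p.-tuple rat,
    qform A (\col_i ratr (tnth q i)) < a * qform 1%:M (\col_i ratr (tnth q i)).
Proof.
move=> sA; split=> [la|[q qa]]; last first.
  have := le_lt_trans (lambda_min_le _ sA) qa.
  apply: contraTT; rewrite -!leNgt => al.
  by rewrite ler_wpM2r // qform1_ge0.
have [v v0 [qv _]] := lambda_min_spec sA p0.
pose f v := qform A v - a * qform 1%:M v.
have := @open_ratcol _ [set v | f v < 0] v; case.
- apply: (@open_comp _ _ f [set x | x < 0]); last exact: open_lt.
  move=> w _; apply: (@continuousB _ R^o _ (qform A) (fun w => a * qform 1%:M w)).
    exact: qform_continuous.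
  apply: (@continuousM _ _ (cst a) (qform 1%:M)); first exact: cst_continuous.
  exact: qform_continuous.
- by rewrite /= /f qv subr_lt0 ltr_pM2r // qform1_gt0.
- by move=> q; rewrite /= /f subr_lt0; exists q.
Qed.

(** Stated for a family of symmetric matrices so that it also applies to the opposite of the Gram
    matrix, which yields [lambda_max]. *)
Lemma measurable_lambda_min_form (A : T -> 'M[R]_p) :
  (forall w, (A w)^T = A w) ->
  (forall v, measurable_fun setT (fun w => qform (A w) v)) ->
  measurable_fun setT (fun w => lambda_min (A w)).
Proof.
move=> sA mA; apply: measurable_fun_lt_sets => a.
rewrite (_ : [set w | _] = \bigcup_(q : p.-tuple rat)
    [set w | qform (A w) (\col_i ratr (tnth q i)) <
             a * qform 1%:M (\col_i ratr (tnth q i))]).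
  apply: countable_bigcupT_measurable => [|q]; first exact: countableP.
  by apply: measurable_lt_set => //; exact: mA.
apply/seteqP; split => w /=.
  by move=> /(lambda_min_ltP _ (sA w))[q]; exists q.
by move=> [q _ qa]; apply/(lambda_min_ltP _ (sA w)); exists q.
Qed.

Lemma measurable_lambda_min : measurable_fun setT (fun w => lambda_min (gram (H w))).
Proof.
apply: measurable_lambda_min_form => [w|v]; first exact: gram_sym.
exact: measurable_qform_gram.
Qed.

Lemma measurable_lambda_max : measurable_fun setT (fun w => lambda_max (gram (H w))).
Proof.
under eq_fun do rewrite lambda_maxE.
apply: measurableT_comp => //.
apply: measurable_lambda_min_form => [w|v]; first by rewrite linearN /= gram_sym.
under eq_fun do rewrite /qform bform_opp.
apply: measurableT_comp => //; exact: measurable_qform_gram.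
Qed.

End with_histories.
End measurability.

(** * Gaussian integrals *)

Section gaussian_integral.
Context {R : realType}.

(** The integrand is a multiple of the normal density with mean m and standard deviation s / sqrt
    a. *)
Lemma integral_gaussian (c a m s : R) : 0 <= c -> 0 < a -> 0 < s ->
  (\int[@lebesgue_measure R]_x
      (c * expR (- (a * (x - m) ^+ 2) / (s ^+ 2 *+ 2)))%:E =
   (c * (Num.sqrt (pi *+ 2) * s / Num.sqrt a))%:E)%E.
Proof.
move=> c0 a0 s0; pose s' := s / Num.sqrt a.
have sa0 : 0 < Num.sqrt a by rewrite sqrtr_gt0.
have s'0 : 0 < s' by rewrite divr_gt0.
have pi2 : 0 <= pi *+ 2 :> R by rewrite mulrn_wge0 // pi_ge0.
have peakE : (normal_peak s')^-1 = Num.sqrt (pi *+ 2) * s / Num.sqrt a.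
  rewrite /normal_peak invrK -mulrnAr sqrtrM ?sqr_ge0 // sqrtr_sqr gtr0_norm //.
  by rewrite /s' mulrC mulrA.
have eqf x : c * expR (- (a * (x - m) ^+ 2) / (s ^+ 2 *+ 2)) =
    c * (normal_peak s')^-1 * normal_pdf m s' x.
  have -> : normal_pdf m s' x = normal_peak s' * normal_fun m s' x.
    by rewrite normal_pdfE ?gt_eqF.
  rewrite -mulrA; congr (c * _).
  rewrite [RHS]mulrA mulVf ?mul1r ?gt_eqF ?normal_peak_gt0 ?gt_eqF //.
  rewrite /normal_fun; congr expR.
  rewrite /s' exprMn exprVn sqr_sqrtr ?(ltW a0) //; field.
  by rewrite !gt_eqF.
under eq_integral do rewrite eqf EFinM.
rewrite ge0_integralZl //=.
- by rewrite integral_normal_pdf mule1 peakE.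
- apply/measurable_EFinP; exact: measurable_normal_pdf.
- by move=> x _; rewrite lee_fin normal_pdf_ge0.
- by rewrite lee_fin mulr_ge0 // invr_ge0 normal_peak_ge0.
Qed.

Lemma col_of_cons k (x : R) (v : k.-tuple R) :
  col_of (cons_tuple x v) = col_mx x%:M (col_of v) :> 'cV_(1 + k).
Proof.
apply/colP => i; rewrite mxE; case: (split_ordP i) => j ->.
  rewrite col_mxEu mxE ord1 /= mulr1n.
  by rewrite (_ : lshift k 0 = ord0) ?tnth0 //; apply/val_inj.
rewrite col_mxEd mxE (_ : rshift 1 j = lift ord0 j) ?tnthS //.
exact/val_inj.
Qed.

(** Induction on the dimension by [schur_complement]: in the inner exponent the first coordinate
    merely shifts the centre, which leaves the inner integral unchanged, and a one-dimensional
    Gaussian integral remains. The factor [c] absorbs the exponential that depends on the first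
    coordinate. *)
Lemma iint_gaussian k (W : 'M[R]_k) (mu : 'cV[R]_k) (s c : R) :
  posdef W -> 0 < s -> 0 <= c ->
  iint (fun t => (c * expR (- qform W (col_of t - mu) / (s ^+ 2 *+ 2)))%:E) =
  (c * ((Num.sqrt (pi *+ 2) * s) ^+ k / Num.sqrt (\det W)))%:E.
Proof.
move=> pW s0; elim: k W mu c pW => [|k IH] W mu c pW c0 /=.
  rewrite det_mx00 sqrtr1 expr0 divr1 [_ - mu](_ : _ = 0) ?qform0 ?oppr0 ?mul0r.
    by rewrite expR0.
  by apply/colP => -[].
have [s1 [m [s10 _ dW pW' dec]]] := @schur_complement _ k W pW.
set W' := drsubmx _ in dW pW' dec; pose mu1 : 'cV[R]_(1 + k) := mu.
pose m0 := usubmx mu1 0 0; pose m1 := dsubmx mu1.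
have qE x (v : k.-tuple R) : qform W (col_of (cons_tuple x v) - mu) =
    s1 * (x - m0) ^+ 2 + qform W' (col_of v - (m1 + (x - m0) *: m)).
  rewrite opprD addrA -dec; congr (qform W _).
  transitivity (col_mx x%:M (col_of v) - mu1); first by rewrite -col_of_cons.
  rewrite -[mu1 in LHS]vsubmxK opp_col_mx add_col_mx.
  by rewrite [usubmx mu1]mx11_scalar -/m0 raddfB.
under eq_integral => x _.
  rewrite (_ : (fun v => _) = (fun v : k.-tuple R =>
     (c * expR (- (s1 * (x - m0) ^+ 2) / (s ^+ 2 *+ 2)) *
      expR (- qform W' (col_of v - (m1 + (x - m0) *: m)) / (s ^+ 2 *+ 2)))%:E)).
    rewrite IH //; last by rewrite mulr_ge0 // expR_ge0.
    over.
  by apply/funext => v; rewrite qE opprD mulrDl expRD mulrA.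
under eq_integral do rewrite mulrAC.
rewrite integral_gaussian //; last first.
  apply: mulr_ge0 => //; apply: divr_ge0; last exact: sqrtr_ge0.
  by rewrite exprn_ge0 // mulr_ge0 ?sqrtr_ge0 // ltW.
congr EFin; rewrite dW sqrtrM ?(ltW s10) // exprS invfM; ring.
Qed.

End gaussian_integral.

(** * Total variation distance between densities *)

Section iint_theory.
Context {R : realType} (p : nat).
Implicit Types F G : p.-tuple R -> R.

Lemma iint_real F : (forall t, 0 <= F t) -> measurable_fun setT F ->
  iint (fun t => (F t)%:E) = (\int[lebtuple p]_t (F t)%:E)%E.
Proof.
move=> F0 mF; rewrite iintE //; exact/measurable_EFinP.
Qed.

Lemma iint_ge0 F : (forall t, 0 <= F t) -> measurable_fun setT F ->
  (0 <= iint (fun t => (F t)%:E))%E.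
Proof.
by move=> F0 mF; rewrite iint_real // integral_ge0 // => t _; rewrite lee_fin.
Qed.

Lemma iintD F G : (forall t, 0 <= F t) -> measurable_fun setT F ->
  (forall t, 0 <= G t) -> measurable_fun setT G ->
  iint (fun t => (F t + G t)%:E) =
  (iint (fun t => (F t)%:E) + iint (fun t => (G t)%:E))%E.
Proof.
move=> F0 mF G0 mG; rewrite !iint_real //.
- under eq_integral do rewrite EFinD.
  by rewrite ge0_integralD //=;
    by [exact/measurable_EFinP|move=> t _; rewrite lee_fin].
- by move=> t; rewrite addr_ge0.
- exact: measurable_funD.
Qed.

Lemma iintZ c F : 0 <= c -> (forall t, 0 <= F t) -> measurable_fun setT F ->
  iint (fun t => (c * F t)%:E) = (c%:E * iint (fun t => (F t)%:E))%E.
Proof.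
move=> c0 F0 mF; rewrite !iint_real //.
- under eq_integral do rewrite EFinM.
  by rewrite ge0_integralZl //=;
    by [exact/measurable_EFinP|move=> t _; rewrite lee_fin].
- by move=> t; rewrite mulr_ge0.
- exact: measurable_funM.
Qed.

Lemma iint_lin a b F G : 0 <= a -> 0 <= b ->
  (forall t, 0 <= F t) -> measurable_fun setT F ->
  (forall t, 0 <= G t) -> measurable_fun setT G ->
  iint (fun t => (a * F t + b * G t)%:E) =
  (a%:E * iint (fun t => (F t)%:E) + b%:E * iint (fun t => (G t)%:E))%E.
Proof.
move=> a0 b0 F0 mF G0 mG; rewrite iintD.
- by rewrite iintZ // (iintZ b0).
- by move=> t; rewrite mulr_ge0.
- exact: measurable_funM.
- by move=> t; rewrite mulr_ge0.
- exact: measurable_funM.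
Qed.

Lemma iint_le F G : (forall t, 0 <= F t) -> measurable_fun setT F ->
  measurable_fun setT G -> (forall t, F t <= G t) ->
  (iint (fun t => (F t)%:E) <= iint (fun t => (G t)%:E))%E.
Proof.
move=> F0 mF mG FG; have G0 t : 0 <= G t := le_trans (F0 t) (FG t).
by rewrite !iint_real //; apply: ge0_le_integral => //=;
  by [exact/measurable_EFinP|move=> t _; rewrite lee_fin].
Qed.

(* The supremum defining TV is attained at the set where f < g. *)
Lemma TV_densities (f g : 'cV[R]_p -> R) :
  (forall b, 0 <= f b) -> (forall b, 0 <= g b) ->
  measurable_fun setT (fun t : p.-tuple R => f (col_of t)) ->
  measurable_fun setT (fun t : p.-tuple R => g (col_of t)) ->
  iint (fun t => (f (col_of t))%:E) = 1%E ->
  iint (fun t => (g (col_of t))%:E) = 1%E ->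
  TV f g = iint (fun t => (Num.max 0 (g (col_of t) - f (col_of t)))%:E).
Proof.
move=> f0 g0; set F := fun t : p.-tuple R => f (col_of t).
set G := fun t : p.-tuple R => g (col_of t) => mF mG F1 G1.
(* [M] is the part common to both densities; [N] and [P] are the excesses of [F] and [G] over it. *)
pose P (t : p.-tuple R) : R := Num.max 0 (G t - F t).
pose N (t : p.-tuple R) : R := Num.max 0 (F t - G t).
pose M (t : p.-tuple R) : R := Num.min (F t) (G t).
have F0 t : 0 <= F t by exact: f0.
have G0 t : 0 <= G t by exact: g0.
have P0 t : 0 <= P t by rewrite /P le_max lexx.
have N0 t : 0 <= N t by rewrite /N le_max lexx.
have M0 t : 0 <= M t by rewrite /M le_min F0 G0.
have mP : measurable_fun setT P.
  by apply: measurable_maxr => //; exact: measurable_funB.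
have mN : measurable_fun setT N.
  by apply: measurable_maxr => //; exact: measurable_funB.
have mM : measurable_fun setT M by exact: measurable_minr.
have FE t : F t = M t + N t.
  by rewrite /M /N; case: (leP (F t) (G t)) => ?; case: leP => ?; lra.
have GE t : G t = M t + P t.
  by rewrite /M /P; case: (leP (F t) (G t)) => ?; case: leP => ?; lra.
pose I (H : p.-tuple R -> R) := iint (fun t => (H t)%:E).
pose r (A : set (p.-tuple R)) (H : p.-tuple R -> R) (t : p.-tuple R) : R :=
  \1_A t * H t.
have I1 (A : set (p.-tuple R)) (H : p.-tuple R -> R) :
    measurable A -> (forall t, 0 <= H t) ->
    measurable_fun setT H -> (forall t, H t <= F t) \/ (forall t, H t <= G t) ->
    [/\ forall t, 0 <= r A H t, measurable_fun setT (r A H),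
      I (r A H) \is a fin_num & (I (r A H) <= I H)%E].
  move=> mA H0 mH HFG.
  have AH0 t : 0 <= r A H t by rewrite /r mulr_ge0 // indicE.
  have mAH : measurable_fun setT (r A H).
    by apply: measurable_funM => //; exact: measurable_indic.
  have AHH t : r A H t <= H t.
    by rewrite /r ler_piMl // indicE lern1 leq_b1.
  have AHI : (I (r A H) <= I H)%E by apply: iint_le.
  split=> //; rewrite ge0_fin_numE; last exact: iint_ge0.
  apply: le_lt_trans AHI _; case: HFG => [HF|HG].
    by apply: (@le_lt_trans _ _ (I F)); [exact: iint_le|rewrite /I F1 ltry].
  by apply: (@le_lt_trans _ _ (I G)); [exact: iint_le|rewrite /I G1 ltry].
have MF : (forall t, M t <= F t) \/ (forall t, M t <= G t).
  by left => t; rewrite /M ge_min lexx.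
have NF : (forall t, N t <= F t) \/ (forall t, N t <= G t).
  by left => t; rewrite FE lerDr.
have PG : (forall t, P t <= F t) \/ (forall t, P t <= G t).
  by right => t; rewrite GE lerDr.
have split_ (A : set (p.-tuple R)) : measurable A ->
    I (r A F) = (I (r A M) + I (r A N))%E /\
    I (r A G) = (I (r A M) + I (r A P))%E.
  move=> mA; have [a1 a2 _ _] := I1 A M mA M0 mM MF.
  have [b1 b2 _ _] := I1 A N mA N0 mN NF.
  have [c1 c2 _ _] := I1 A P mA P0 mP PG.
  rewrite -!iintD //; split; congr iint; apply/funext => t.
    by rewrite /r FE mulrDr.
  by rewrite /r GE mulrDr.
have eT (H : p.-tuple R -> R) : (r setT H) = H.
  by apply/funext => t; rewrite /r indicE in_setT mul1r.
(* Both densities have mass 1, so the two excesses have equal mass. *)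
have NP : I N = I P.
  have := split_ setT measurableT; rewrite !eT /I F1 G1 => -[FN GP].
  have [_ _ fM _] := I1 setT M measurableT M0 mM MF; rewrite eT in fM.
  have [_ _ fN _] := I1 setT N measurableT N0 mN NF; rewrite eT in fN.
  have [_ _ fP _] := I1 setT P measurableT P0 mP PG; rewrite eT in fP.
  move: FN GP; rewrite -/(I M) -/(I N) -/(I P).
  rewrite -(fineK fM) -(fineK fN) -(fineK fP) -!EFinD => -[h1] -[h2].
  by congr EFin; lra.
apply/eqP; rewrite eq_le; apply/andP; split.
  (* On A the common part cancels, leaving the difference of two numbers between 0 and [I P]. *)
  apply: ge_ereal_sup => _ [A mA ->].
  change (`|I (r A F) - I (r A G)| <= I P)%E.
  have [-> ->] := split_ A mA.
  have [_ _ fM _] := I1 A M mA M0 mM MF.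
  have [nA mnA fN leN] := I1 A N mA N0 mN NF.
  have [pA mpA fP leP] := I1 A P mA P0 mP PG.
  have := iint_ge0 nA mnA; have := iint_ge0 pA mpA.
  rewrite -/(I (r A N)) -/(I (r A P)); rewrite NP in leN.
  rewrite -(fineK fM) -(fineK fN) -(fineK fP) in leN leP *.
  rewrite -!EFinD abse_EFin !lee_fin => p0 n0.
  case: (I P) leN leP => [x| |] //=; rewrite ?leey // !lee_fin => h1 h2.
  by rewrite ler_norml; apply/andP; split; lra.
apply: ereal_sup_ubound.
have mA : measurable [set t | F t < G t] by exact: measurable_lt_set.
exists [set t | F t < G t] => //; set A := [set t | _] in mA *.
change (I P = `|I (r A F) - I (r A G)|)%E.
have [-> ->] := split_ _ mA.
have [_ _ fM _] := I1 _ M mA M0 mM MF.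
have -> : (r A P) = P.
  apply/funext => t; rewrite /r indicE /P.
  case: (boolP (t \in A)) => [|]; rewrite ?mul1r //.
  by rewrite notin_setE /A /= => /negP; rewrite -leNgt -subr_le0 mul0r => /max_idPl ->.
have -> : I (r A N) = 0%E.
  rewrite /I (_ : (fun t => _) = fun t => (0 * F t)%:E).
    by rewrite iintZ // mul0e.
  apply/funext => t; rewrite /r indicE /N mul0r.
  case: (boolP (t \in A)) => [|]; last by rewrite mul0r.
  by rewrite inE /A /= => /ltW; rewrite -subr_le0 => /max_idPl ->; rewrite mulr0.
have [_ _ fP _] := I1 setT P measurableT P0 mP PG; rewrite eT in fP.
have := iint_ge0 P0 mP; rewrite -/(I P) -(fineK fM) -(fineK fP) lee_fin => P_ge0.
rewrite adde0 -!EFinD abse_EFin; congr EFin.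
by rewrite opprD addrA subrr add0r normrN ger0_norm.
Qed.

End iint_theory.

(** * Integration along the sampling procedure *)

Section integral_functionals.
Context {R : realType}.
Local Open Scope ereal_scope.

Definition nnmeas d (T : measurableType d) (f : T -> \bar R) : Prop :=
  measurable_fun setT f /\ forall x, 0 <= f x.

(** An integral known through its properties. The law of a history is given by iterated integrals
    with history-dependent kernels; such functionals are closed under composition and determined by
    their values on indicators, so no joint measure has to be constructed. *)
Record integral_functional d (T : measurableType d)
    (Phi : (T -> \bar R) -> \bar R) : Prop := {
  ifun_ge0 : forall f, nnmeas f -> 0 <= Phi f ;
  ifunD : forall f g, nnmeas f -> nnmeas g ->
    Phi (fun x => f x + g x) = Phi f + Phi g ;
  ifunZ : forall (c : R) f, (0 <= c)%R -> nnmeas f ->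
    Phi (fun x => c%:E * f x) = c%:E * Phi f ;
  ifun_le : forall f g, nnmeas f -> nnmeas g -> (forall x, f x <= g x) ->
    Phi f <= Phi g ;
  ifun_cvg : forall (f_ : nat -> T -> \bar R) f, (forall n, nnmeas (f_ n)) ->
    nnmeas f -> (forall x, nondecreasing_seq (f_ ^~ x)) ->
    (forall x, f_ n x @[n --> \oo] --> f x) ->
    Phi (f_ n) @[n --> \oo] --> Phi f }.

Lemma integral_functional_integral d (T : measurableType d)
    (mu : {measure set T -> \bar R}) :
  integral_functional (fun f : T -> \bar R => \int[mu]_x f x).
Proof.
split.
- by move=> f [_ f0]; exact: integral_ge0.
- by move=> f g [mf f0] [mg g0]; rewrite ge0_integralD.
- by move=> c f c0 [mf f0]; rewrite ge0_integralZl.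
- by move=> f g [mf f0] [mg g0] fg; apply: ge0_le_integral.
- move=> f_ f nf_ _ ndf cf.
  have -> : \int[mu]_x f x = \int[mu]_x limn (f_ ^~ x).
    by apply: eq_integral => x _; apply/esym/cvg_lim => //; exact: cf.
  apply: cvg_monotone_convergence => //.
  + by move=> n; have [] := nf_ n.
  + by move=> n x _; have [_ ->] := nf_ n.
Qed.

(** Covers iterated integration: monotonicity of each [L s] makes the inner integrals an increasing
    sequence, to which the convergence property of [Phi] applies. *)
Lemma integral_functional_comp d d' (S : measurableType d) (T : measurableType d')
    (Phi : (S -> \bar R) -> \bar R) (L : S -> (T -> \bar R) -> \bar R) :
  integral_functional Phi -> (forall s, integral_functional (L s)) ->
  (forall f, nnmeas f -> measurable_fun setT (L ^~ f)) ->
  integral_functional (fun f => Phi (L ^~ f)).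
Proof.
move=> iPhi iL mL; have nL f : nnmeas f -> nnmeas (L ^~ f).
  by move=> nf; split=> [|s]; [exact: mL|exact: ifun_ge0].
split.
- by move=> f nf; apply: ifun_ge0 => //; exact: nL.
- move=> f g nf ng; rewrite -(ifunD iPhi) //; try exact: nL.
  by congr Phi; apply/funext => s; rewrite (ifunD (iL s)).
- move=> c f c0 nf; rewrite -(ifunZ iPhi) //; last exact: nL.
  by congr Phi; apply/funext => s; rewrite (ifunZ (iL s)).
- move=> f g nf ng fg; apply: (ifun_le iPhi); try exact: nL.
  by move=> s; apply: (ifun_le (iL s)).
- move=> f_ f nf_ nf ndf cf; apply: (ifun_cvg iPhi).
  + by move=> n; exact: nL.
  + exact: nL.
  + move=> s m n mn; apply: (ifun_le (iL s)) => // x; exact: ndf.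
  + by move=> s; exact: (ifun_cvg (iL s)).
Qed.

Lemma integral_functional_weight d d' (S : measurableType d) (T : measurableType d')
    (Phi : (S -> \bar R) -> \bar R) (phi : S -> T) (k : S -> R) :
  integral_functional Phi -> measurable_fun setT phi ->
  measurable_fun setT k -> (forall s, (0 <= k s)%R) ->
  integral_functional (fun f => Phi (fun s => (k s)%:E * f (phi s))).
Proof.
move=> iPhi mphi mk k0.
apply: (@integral_functional_comp _ _ _ _ Phi (fun s f => (k s)%:E * f (phi s))) => //.
  move=> s; split.
  - by move=> f [_ f0]; rewrite mule_ge0 // lee_fin.
  - by move=> f g [_ f0] [_ g0]; rewrite ge0_muleDr.
  - by move=> c f c0 _; rewrite muleCA.
  - by move=> f g _ _ fg; rewrite lee_wpmul2l // lee_fin.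
  - by move=> f_ f _ _ _ cf; apply: cvgeZl.
move=> f [mf _]; apply: emeasurable_funM; first exact/measurable_EFinP.
exact: measurableT_comp.
Qed.

Import HBNNSimple.

(** Linearity extends the equality from indicators to simple functions, and increasing limits extend
    it to all nonnegative measurable functions. *)
Lemma integral_functional_unique d (T : measurableType d)
    (Phi Psi : (T -> \bar R) -> \bar R) :
  integral_functional Phi -> integral_functional Psi ->
  (forall A, measurable A ->
     Phi (fun x => (\1_A x)%:E) = Psi (fun x => (\1_A x)%:E)) ->
  forall f, nnmeas f -> Phi f = Psi f.
Proof.
move=> iPhi iPsi ePP.
have nind (A : set T) (c : R) : measurable A -> (0 <= c)%R ->
    nnmeas (fun x => c%:E * (\1_A x)%:E).
  move=> mA c0; split=> [|x]; last by rewrite mule_ge0 // lee_fin // indicE.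
  by apply: measurable_funeM; apply/measurable_EFinP; exact: measurable_indic.
have nind1 (A : set T) : measurable A -> nnmeas (fun x => (\1_A x)%:E : \bar R).
  move=> mA; split=> [|x]; last by rewrite lee_fin indicE.
  by apply/measurable_EFinP; exact: measurable_indic.
have step (g : {nnsfun T >-> R}) : nnmeas (fun x => (g x)%:E : \bar R) /\
    Phi (fun x => (g x)%:E) = Psi (fun x => (g x)%:E).
  have gE x : (g x)%:E = \sum_(y <- finmap.enum_fset (fset_set (range g)))
      (y%:E * (\1_(g @^-1` [set y]) x)%:E).
    by rewrite fimfunE fsbig_finite // -sumEFin.
  under [X in nnmeas X]eq_fun do rewrite gE.
  under [X in Phi X = _]eq_fun do rewrite gE.
  under [X in _ = Psi X]eq_fun do rewrite gE.
  have : {in finmap.enum_fset (fset_set (range g)), forall y, (0 <= y)%R}.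
    by move=> y; rewrite in_fset_set // inE => -[x _ <-].
  elim: {gE} (finmap.enum_fset _) => [_|y s IH ys].
    under [X in nnmeas X]eq_fun do rewrite big_nil.
    under [X in Phi X = _]eq_fun do rewrite big_nil.
    under [X in _ = Psi X]eq_fun do rewrite big_nil.
    split; first by split.
    (* The empty sum is the indicator of the empty set. *)
    have := ePP set0 measurable0.
    under [X in Phi X = _ -> _]eq_fun do rewrite indic0.
    by under [X in _ = Psi X -> _]eq_fun do rewrite indic0.
  have y0 : (0 <= y)%R by apply: ys; rewrite inE eqxx.
  have [ns es] := IH (fun z zs => ys z (mem_behead (s := y :: s) zs)).
  have mg : measurable (g @^-1` [set y]) by [].
  have [mA A0] := nind _ _ mg y0.
  under [X in nnmeas X]eq_fun do rewrite big_cons.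
  under [X in Phi X = _]eq_fun do rewrite big_cons.
  under [X in _ = Psi X]eq_fun do rewrite big_cons.
  split.
    case: ns => ms s0; split; first exact: emeasurable_funD.
    by move=> x; rewrite adde_ge0.
  rewrite (ifunD iPhi) // (ifunD iPsi) // es (ifunZ iPhi) ?(ifunZ iPsi) //.
  + by rewrite ePP.
  + exact: nind1.
  + exact: nind1.
move=> f [mf f0]; pose f_ := nnsfun_approx measurableT mf.
have ndf x : nondecreasing_seq (fun n => (f_ n x)%:E).
  by move=> a b ab; rewrite lee_fin; exact/lefP/nd_nnsfun_approx.
have cf x : (f_ n x)%:E @[n --> \oo] --> f x by exact: cvg_nnsfun_approx.
have c1 := ifun_cvg iPhi (fun n => (step (f_ n)).1) (conj mf f0) ndf cf.
have c2 := ifun_cvg iPsi (fun n => (step (f_ n)).1) (conj mf f0) ndf cf.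
move: c1; under eq_fun do rewrite (step (f_ _)).2.
by move=> c1; exact: (cvg_unique _ c1 c2).
Qed.

(** Both sides are integral functionals, and on indicators the equality is the definition of
    [normal_prob]. *)
Lemma integral_normal_prob (m s : R) (f : R -> \bar R) : nnmeas f ->
  \int[normal_prob m s]_y f y =
  \int[@lebesgue_measure R]_y ((normal_pdf m s y)%:E * f y).
Proof.
move=> nf.
apply: (@integral_functional_unique _ _ (fun f => \int[normal_prob m s]_y f y)
  (fun f => \int[@lebesgue_measure R]_y ((normal_pdf m s y)%:E * f y))) => //.
- exact: integral_functional_integral.
- apply: (@integral_functional_weight _ _ _ _
    (fun f => \int[@lebesgue_measure R]_y f y) id) => //.
  + exact: integral_functional_integral.
  + exact: measurable_normal_pdf.
  + exact: normal_pdf_ge0.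
- move=> A mA; rewrite integral_indic // setIT [LHS]integral_mkcond.
  apply: eq_integral => y _; rewrite patchE indicE.
  by case: (y \in A); rewrite ?mule1 ?mule0.
Qed.

End integral_functionals.

Lemma tnth_rcons_widen (T : Type) n (h : n.-tuple T) (o : T) (i : 'I_n) :
  tnth (rcons_tuple h o) (widen_ord (leqnSn n) i) = tnth h i.
Proof.
rewrite (tnth_nth o) /= nth_rcons size_tuple ltn_ord.
by rewrite (tnth_nth o).
Qed.

Lemma tnth_rcons_max (T : Type) n (h : n.-tuple T) (o : T) :
  tnth (rcons_tuple h o) ord_max = o.
Proof. by rewrite (tnth_nth o) /= nth_rcons size_tuple ltnn eqxx. Qed.

Lemma measurable_rcons d1 d2 (T1 : measurableType d1) (T2 : measurableType d2)
    n (f : T1 -> n.-tuple T2) (g : T1 -> T2) :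
  measurable_fun setT f -> measurable_fun setT g ->
  measurable_fun setT (fun x => rcons_tuple (f x) (g x)).
Proof.
move=> mf mg; apply/measurable_fun_tnthP => i.
case: (ltnP i n) => ni.
  have -> : i = widen_ord (leqnSn n) (Ordinal ni) by exact: val_inj.
  rewrite (_ : _ \o _ = fun x => tnth (f x) (Ordinal ni)); last first.
    by apply/funext => x /=; rewrite tnth_rcons_widen.
  exact: (measurableT_comp (@measurable_tnth _ _ _ _) mf).
have -> : i = ord_max.
  by apply: val_inj; apply/eqP; rewrite eqn_leq ni -ltnS ltn_ord.
rewrite (_ : _ \o _ = g) //; apply/funext => x /=.
by rewrite tnth_rcons_max.
Qed.

(** * Law of the sampled history and mean of the likelihood ratio *)

Section sampling.
Context {R : realType} (p : nat) (sigma : R) (beta0 : 'cV[R]_p).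
Context (Lambda : forall j : nat, R.-pker (hist R p j) ~> p.-tuple R).
Context d (Omega : measurableType d) (P : probability Omega R).
Context (X : nat -> Omega -> p.-tuple R) (Y : nat -> Omega -> R).
Hypothesis s0 : 0 < sigma.
Hypothesis mX : forall j, measurable_fun setT (X j).
Hypothesis mY : forall j, measurable_fun setT (Y j).
Hypothesis gen : forall n (A : set (hist R p n.+1)), measurable A ->
     P (history X Y n.+1 @^-1` A) =
     (\int[P]_w \int[Lambda n (history X Y n w)]_x
        \int[normal_prob (((col_of x)^T *m beta0) ord0 ord0) sigma]_y
           (\1_A (rcons_tuple (history X Y n w) (x, y)) : R)%:E)%E.

Lemma measurable_history n : measurable_fun setT (history X Y n).
Proof.
apply/measurable_fun_tnthP => i.
rewrite (_ : _ \o _ = fun w => (X i w, Y i w)); last first.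
  by apply/funext => w; rewrite /= tnth_mktuple.
exact: measurable_fun_pair.
Qed.

Lemma measurable_lin d1 (T : measurableType d1) (f : T -> p.-tuple R)
    (b : 'cV[R]_p) :
  measurable_fun setT f ->
  measurable_fun setT (fun x => ((col_of (f x))^T *m b) ord0 ord0).
Proof.
move=> mf; have -> : b = col_of [tuple b i ord0 | i < p].
  by apply/colP => i; rewrite mxE tnth_mktuple.
exact: measurable_dot.
Qed.

Lemma measurable_normal_pdf2 d1 (T : measurableType d1) (m y : T -> R) :
  measurable_fun setT m -> measurable_fun setT y ->
  measurable_fun setT (fun x => normal_pdf (m x) sigma (y x)).
Proof.
move=> mm my.
have -> : (fun x => normal_pdf (m x) sigma (y x)) =
    fun x => normal_peak sigma * normal_fun (m x) sigma (y x).
  by apply/funext => x; rewrite normal_pdfE // gt_eqF.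
apply: measurable_funM => //; apply: measurableT_comp => //.
apply: measurable_funM => //; apply: measurableT_comp => //.
by apply: measurable_funX; exact: measurable_funB.
Qed.

Local Open Scope ereal_scope.

(** The integrand of one sampling step, with the law of the response unfolded into its density.
    History, covariate and response form a single argument so that joint measurability can be
    stated. *)
Definition step_density n (F : hist R p n.+1 -> \bar R)
    (z : hist R p n * p.-tuple R * R) : \bar R :=
  (normal_pdf (((col_of z.1.2)^T *m beta0) ord0 ord0) sigma z.2)%:E *
  F (rcons_tuple z.1.1 (z.1.2, z.2)).

Lemma step_density_nnmeas n (F : hist R p n.+1 -> \bar R) : nnmeas F ->
  nnmeas (step_density F).
Proof.
move=> [mF F0]; split=> [|z]; last by rewrite mule_ge0 // lee_fin normal_pdf_ge0.
apply: emeasurable_funM.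
  apply/measurable_EFinP; apply: measurable_normal_pdf2 => //.
  apply: measurable_lin.
  exact: (measurableT_comp measurable_snd measurable_fst).
apply: (measurableT_comp mF); apply: measurable_rcons.
  exact: (measurableT_comp measurable_fst measurable_fst).
apply: measurable_fun_pair => //.
exact: (measurableT_comp measurable_snd measurable_fst).
Qed.

(** Extends [gen], which speaks of sets, to nonnegative functions: both sides are integral
    functionals that agree on indicators. *)
Lemma history_step n (F : hist R p n.+1 -> \bar R) : nnmeas F ->
  \int[P]_w F (history X Y n.+1 w) =
  \int[P]_w \int[Lambda n (history X Y n w)]_x
    \int[@lebesgue_measure R]_y step_density F (history X Y n w, x, y).
Proof.
have m1 G : nnmeas G -> nnmeas (fun z : hist R p n * p.-tuple R =>
    \int[@lebesgue_measure R]_y step_density G (z, y)).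
  move=> /step_density_nnmeas[mG G0]; split=> [|z]; last exact: integral_ge0.
  exact: (@measurable_fun_fubini_tonelli_F _ _ _ _ _ (@lebesgue_measure R) _ mG G0).
have m2 G : nnmeas G -> measurable_fun setT (fun h : hist R p n =>
    \int[Lambda n h]_x \int[@lebesgue_measure R]_y step_density G (h, x, y)).
  move=> /m1[mG G0].
  exact: (measurable_fun_integral_finite_kernel _ (Lambda n) G0 mG).
apply: (@integral_functional_unique _ _ _
  (fun F => \int[P]_w F (history X Y n.+1 w))
  (fun F => \int[P]_w \int[Lambda n (history X Y n w)]_x
    \int[@lebesgue_measure R]_y step_density F (history X Y n w, x, y))).
(* The weight 1 reduces this to composition with [history]. *)
- have := @integral_functional_weight R _ _ _ _ _ (history X Y n.+1) (cst 1%R)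
    (integral_functional_integral P) (@measurable_history n.+1).
  under eq_fun do under eq_integral do rewrite mul1e.
  by apply.
- apply: (integral_functional_comp (integral_functional_integral P)
    (L := fun w F => \int[Lambda n (history X Y n w)]_x
    \int[@lebesgue_measure R]_y step_density F (history X Y n w, x, y))).
    move=> w; set h := history X Y n w.
    apply: (integral_functional_comp (integral_functional_integral (Lambda n h))
      (L := fun x F => \int[@lebesgue_measure R]_y step_density F (h, x, y))).
      move=> x.
      apply: (@integral_functional_weight R _ _ _ _
        (fun f => \int[@lebesgue_measure R]_y f y)
        (fun y => rcons_tuple h (x, y))
        (normal_pdf (((col_of x)^T *m beta0) ord0 ord0) sigma)) => //.
      + exact: integral_functional_integral.
      + by apply: measurable_rcons => //; exact: measurable_fun_pair.
      + exact: measurable_normal_pdf.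
      + by move=> y; exact: normal_pdf_ge0.
    move=> G /m1[mG _].
    by apply: (measurableT_comp mG); exact: measurable_fun_pair.
  move=> G /m2 mG; apply: (measurableT_comp mG); exact: measurable_history.
- move=> A mA; rewrite -[LHS]/(\int[P]_w (\1_(history X Y n.+1 @^-1` A) w)%:E).
  rewrite integral_indic //; last first.
    by rewrite -[X in measurable X]setTI; apply: measurable_history.
  rewrite setIT; apply: (eq_trans (gen mA)).
  apply: eq_integral => w _; apply: eq_integral => x _.
  rewrite integral_normal_prob //; split=> [|y]; last by rewrite lee_fin indicE.
  apply/measurable_EFinP; apply: (measurableT_comp (measurable_indic mA)).
  by apply: measurable_rcons => //; exact: measurable_fun_pair.
Qed.

Lemma lik_gt0 n (h : hist R p n) (b : 'cV[R]_p) : (0 < lik sigma h b)%R.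
Proof. by apply: prodr_gt0 => i _; exact: expR_gt0. Qed.

Lemma lik_rcons n (h : hist R p n) x y (b : 'cV[R]_p) :
  lik sigma (rcons_tuple h (x, y)) b =
  (lik sigma h b * normal_fun (((col_of x)^T *m b) ord0 ord0) sigma y)%R.
Proof.
rewrite /lik big_ord_recr /= tnth_rcons_max; congr (_ * _)%R.
by apply: eq_bigr => i _; rewrite tnth_rcons_widen.
Qed.

Lemma measurable_lik_cst d1 (T : measurableType d1) n
    (H : T -> hist R p n) (b : 'cV[R]_p) :
  measurable_fun setT H -> measurable_fun setT (fun w => lik sigma (H w) b).
Proof.
move=> mH; have -> : b = col_of [tuple b i ord0 | i < p].
  by apply/colP => i; rewrite mxE tnth_mktuple.
exact: measurable_lik.
Qed.

(* The likelihood ratio is a martingale: each new factor turns the conditional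
   density of y into another normal density, hence integrates to 1. *)
Lemma likelihood_ratio_mean n (b : 'cV[R]_p) :
  \int[P]_w (lik sigma (history X Y n w) b / lik sigma (history X Y n w) beta0)%:E
  = 1.
Proof.
elim: n => [|n IH].
  under eq_integral do rewrite /lik !big_ord0 divr1.
  by rewrite integral_cst // mul1e; exact: probability_setT.
pose F (h : hist R p n.+1) : \bar R := (lik sigma h b / lik sigma h beta0)%:E.
have lr0 k (h : hist R p k) : (0 <= lik sigma h b / lik sigma h beta0)%R.
  by rewrite divr_ge0 // ltW // lik_gt0.
have nF : nnmeas F.
  split=> [|h]; last by rewrite lee_fin.
  apply/measurable_EFinP; apply: measurable_funM; first exact: measurable_lik_cst.
  (* The likelihood is positive, so its inverse is a composite of measurable functions through [ln]
     and [expR]. *)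
  have -> : (fun h : hist R p n.+1 => (lik sigma h beta0)^-1%R) =
    (fun h => expR (- ln (lik sigma h beta0))).
    by apply/funext => h; rewrite expRN lnK // posrE lik_gt0.
  apply: measurableT_comp => //; apply: measurableT_comp => //.
  apply: measurableT_comp => //; exact: measurable_lik_cst.
rewrite (history_step nF) -[RHS]IH; apply: eq_integral => w _.
set h := history X Y n w; set c := (_ / _)%R.
transitivity (\int[Lambda n h]_x c%:E); last first.
  by rewrite integral_cst // prob_kernel mule1.
apply: eq_integral => x _.
transitivity (\int[@lebesgue_measure R]_y
    (c%:E * (normal_pdf (((col_of x)^T *m b) ord0 ord0) sigma y)%:E)).
  apply: eq_integral => y _; rewrite /step_density /F /= -EFinM; congr EFin.
  have sn0 : sigma != 0%R by rewrite gt_eqF.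
  rewrite !lik_rcons !normal_pdfE //= /c.
  have := lik_gt0 h beta0 => /lt0r_neq0 l0.
  have : (normal_fun (((col_of x)^T *m beta0) ord0 ord0) sigma y != 0)%R.
    by rewrite gt_eqF // expR_gt0.
  move: (normal_fun _ sigma y) (normal_fun _ sigma y) => u v v0.
  by field; rewrite l0 v0.
rewrite ge0_integralZl //=.
- by rewrite integral_normal_pdf mule1.
- apply/measurable_EFinP; exact: measurable_normal_pdf.
- by move=> y _; rewrite lee_fin normal_pdf_ge0.
- by rewrite lee_fin lr0.
Qed.

End sampling.

(** * The likelihood and the posterior of a fixed history *)

Lemma measurable_gauss_exp {R : realType} p (V : 'M[R]_p) (m : 'cV[R]_p) (c : R) :
  measurable_fun setT
    (fun t : p.-tuple R => expR (- qform V (col_of t - m) / c)).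
Proof.
apply: measurableT_comp => //; apply: measurable_funM => //.
apply: measurableT_comp => //; under eq_fun do rewrite qform_sum.
have mc i : measurable_fun setT (fun t : p.-tuple R => (col_of t - m) i 0).
  under eq_fun do rewrite mxE [col_of _ _ _]mxE.
  by apply: measurable_funD => //; exact: measurable_tnth.
apply: measurable_sum => i; apply: measurable_sum => j.
by apply: measurable_funM => //; apply: measurable_funM.
Qed.

Section fixed_history.
Context {R : realType} (p n : nat) (sigma : R) (h : hist R p n).
Hypothesis s0 : 0 < sigma.

Definition rss (b : 'cV[R]_p) : R :=
  \sum_i ((tnth h i).2 - ((col_of (tnth h i).1)^T *m b) 0 0) ^+ 2.

Lemma likE b : lik sigma h b = expR (- rss b / (sigma ^+ 2 *+ 2)).
Proof.
rewrite /lik -expR_sum; congr expR.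
by rewrite -big_distrl /= -sumrN.
Qed.

Lemma lik_le1 b : lik sigma h b <= 1.
Proof.
rewrite likE -expR0 ler_expR mulNr oppr_le0 divr_ge0 ?mulrn_wge0 ?sqr_ge0 //.
by apply: sumr_ge0 => i _; rewrite sqr_ge0.
Qed.

Hypothesis ug : gram h \in unitmx.

(** Pythagoras: by the normal equations the residual at [betahat] is orthogonal to the columns of
    the design, so the cross term vanishes. *)
Lemma rss_betahat b : rss b = rss (betahat h) + qform (gram h) (b - betahat h).
Proof.
pose e := yvec h - Xmat h *m betahat h; pose u := b - betahat h.
have Xe : (Xmat h)^T *m e = 0.
  rewrite /e mulmxBr /betahat mulmxA -/(gram h) mulmxA mulmxV // mul1mx.
  by rewrite subrr.
have cross : \sum_i e i 0 * ((col_of (tnth h i).1)^T *m u) 0 0 = 0.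
  have : (e^T *m (Xmat h *m u)) 0 0 = 0.
    by rewrite mulmxA -[e^T *m _]trmxK trmx_mul trmxK Xe trmx0 mul0mx mxE.
  rewrite mxE => E0; rewrite -[RHS]E0.
  apply: eq_bigr => i _; rewrite [e^T _ _]mxE.
  by congr (_ * _); rewrite !mxE; apply: eq_bigr => k _; rewrite !mxE.
have eE i : e i 0 = (tnth h i).2 - ((col_of (tnth h i).1)^T *m betahat h) 0 0.
  rewrite /e !mxE; congr (_ - _).
  by apply: eq_bigr => k _; rewrite !mxE.
have -> : rss b = rss (betahat h) + qform (gram h) u +
    - 2 * (\sum_i e i 0 * ((col_of (tnth h i).1)^T *m u) 0 0).
  rewrite qform_gram mulr_sumr /rss -!big_split /=.
  apply: eq_bigr => i _; rewrite -eE.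
  have -> : (tnth h i).2 - ((col_of (tnth h i).1)^T *m b) 0 0 =
      e i 0 - ((col_of (tnth h i).1)^T *m u) 0 0.
    rewrite eE /u mulmxBr.
    move: ((col_of (tnth h i).1)^T *m b) ((col_of (tnth h i).1)^T *m betahat h).
    by move=> m1 m2; rewrite [(m1 - m2) 0 0]mxE [(- m2) 0 0]mxE; ring.
  ring.
by rewrite cross mulr0 addr0.
Qed.

Lemma lik_betahat b : lik sigma h b =
  lik sigma h (betahat h) * expR (- qform (gram h) (b - betahat h) / (sigma ^+ 2 *+ 2)).
Proof. by rewrite !likE rss_betahat opprD mulrDl expRD. Qed.

(** Normalising constant of the normal density with covariance s^2 V^-1. Both arguments vary: a
    wider Gaussian uses s = sqrt 2 * sigma, and the mixing law uses the identity for V. *)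
Definition gauss_cst (s : R) (V : 'M[R]_p) : R :=
  Num.sqrt (\det V) / (Num.sqrt (pi *+ 2) * s) ^+ p.

Lemma sqrt2pi_gt0 : 0 < Num.sqrt (pi *+ 2) :> R.
Proof. by rewrite sqrtr_gt0 mulrn_wgt0 // pi_gt0. Qed.

Lemma gauss_cst_gt0 s V : 0 < s -> posdef V -> 0 < gauss_cst s V.
Proof.
move=> s_gt0 pV; rewrite divr_gt0 ?sqrtr_gt0 ?posdef_det_gt0 //.
by rewrite exprn_gt0 // mulr_gt0 // sqrt2pi_gt0.
Qed.

Lemma iint_gauss s V mu : 0 < s -> posdef V ->
  iint (fun t => (gauss_cst s V *
    expR (- qform V (col_of t - mu) / (s ^+ 2 *+ 2)))%:E) = 1%E.
Proof.
move=> s_gt0 pV; rewrite iint_gaussian //; last exact/ltW/gauss_cst_gt0.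
by congr EFin; rewrite -invf_div mulfV // gt_eqF // gauss_cst_gt0.
Qed.

Lemma gauss_densityE mu V b : posdef V ->
  gauss_density mu sigma V b =
  gauss_cst sigma V * expR (- qform V (b - mu) / (sigma ^+ 2 *+ 2)).
Proof.
move=> pV; rewrite /gauss_density /qform /bform; congr (_ * _).
have dV := posdef_det_gt0 pV.
rewrite detZ det_inv -exprM mulnC exprM sqrtrM ?sqr_ge0 // sqrtr_sqr.
rewrite sqrtrV ?(ltW dV) //.
rewrite ger0_norm ?exprn_ge0 ?(ltW s0) // invfM invrK /gauss_cst exprMn invfM.
ring.
Qed.

Local Notation g := (gauss_density (betahat h) sigma (gram h)).
Local Notation V := (gram h).

Lemma gauss_density_gt0 b : 0 < g b.
Proof.
have pV := gram_posdef ug.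
by rewrite gauss_densityE // mulr_gt0 ?expR_gt0 // gauss_cst_gt0.
Qed.

Lemma iint_gauss_density : iint (fun t => (g (col_of t))%:E) = 1%E.
Proof.
have pV := gram_posdef ug.
rewrite -(@iint_gauss sigma V (betahat h)) //; congr iint.
by apply/funext => t; rewrite gauss_densityE.
Qed.

Lemma lik_gauss b : lik sigma h b =
  lik sigma h (betahat h) / gauss_cst sigma V * g b.
Proof.
have pV := gram_posdef ug.
have K0 := gauss_cst_gt0 s0 pV.
rewrite gauss_densityE // lik_betahat mulrA divfK // gt_eqF //.
Qed.

Lemma measurable_gauss_density :
  measurable_fun setT (fun t : p.-tuple R => g (col_of t)).
Proof.
have -> : (fun t : p.-tuple R => g (col_of t)) = fun t =>
  gauss_cst sigma V / lik sigma h (betahat h) * lik sigma h (col_of t).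
  apply/funext => t; rewrite [lik _ _ (col_of t)]lik_gauss.
  have K0 := gauss_cst_gt0 s0 (gram_posdef ug).
  by field; rewrite !gt_eqF // lik_gt0.
by apply: measurable_funM => //; exact: measurable_lik.
Qed.

End fixed_history.

(** * The posterior density and its distance to the Gaussian *)

Section posterior_density.
Context {R : realType} (p : nat) (sigma : R) (prior : 'cV[R]_p -> R).
Hypothesis s0 : 0 < sigma.
Hypothesis prior0 : forall b, 0 <= prior b.
Hypothesis cprior : continuous prior.
Hypothesis prior1 : lebRp (fun b => (prior b)%:E) = 1%E.

Let mprior := measurable_continuous_col cprior.

Section one_history.
Context (n : nat) (h : hist R p n).
Local Notation lik := (lik sigma h).
Local Notation post := (posterior prior sigma h).

Let mlik : measurable_fun setT (fun t : p.-tuple R => lik (col_of t)).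
Proof. exact: measurable_lik. Qed.

Let mpl : measurable_fun setT
  (fun t : p.-tuple R => prior (col_of t) * lik (col_of t)).
Proof. exact: measurable_funM. Qed.

Let pl0 b : 0 <= prior b * lik b.
Proof. by rewrite mulr_ge0 // ltW // lik_gt0. Qed.

(** Finite because the likelihood is at most 1 and the prior has mass 1. Positive because the
    likelihood vanishes nowhere, so that a zero integral would make the prior zero almost
    everywhere. Hence [fine] in [posterior] returns the true evidence. *)
Lemma evidence_pos : exists2 Z : R, 0 < Z &
  lebRp (fun b => (prior b * lik b)%:E) = Z%:E.
Proof.
rewrite /lebRp; set J := iint _.
have J0 : (0 <= J)%E by exact: iint_ge0.
have J1 : (J <= 1)%E.
  rewrite -prior1; apply: iint_le => // t.
  by rewrite ler_piMr // lik_le1.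
have Jn0 : J != 0%E.
  apply/negP => /eqP; rewrite /J iint_real // => J00.
  have /ae_eq_integral_abs : measurable_fun setT
      (fun t : p.-tuple R => (prior (col_of t) * lik (col_of t))%:E).
    exact/measurable_EFinP.
  move=> /(_ (lebtuple p) measurableT)[+ _].
  under eq_integral do rewrite gee0_abs ?lee_fin //.
  rewrite J00 => /(_ erefl) ae0.
  have : iint (fun t : p.-tuple R => (prior (col_of t))%:E) = 0%E.
    rewrite iint_real //.
    have -> : (0 = \int[lebtuple p]_t (cst 0 t : \bar R))%E.
      by rewrite integral_cst // mul0e.
    apply: ae_eq_integral => //; first exact/measurable_EFinP.
    apply: filterS ae0 => t /= pl _.
    have /eqP : prior (col_of t) * lik (col_of t) = 0 :> R.
      by apply: EFin_inj; exact: pl.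
    by rewrite mulf_eq0 (gt_eqF (lik_gt0 sigma h _)) orbF => /eqP ->.
  by move: prior1; rewrite /lebRp => -> /eqP; rewrite onee_eq0.
have Jfin : J \is a fin_num by rewrite ge0_fin_numE // (le_lt_trans J1) // ltry.
exists (fine J); last by rewrite fineK.
by rewrite -lte_fin fineK // lt_def Jn0 J0.
Qed.

Lemma posterior_ge0 b : 0 <= post b.
Proof.
rewrite /posterior; have [Z Z0 ->] := evidence_pos.
by rewrite divr_ge0 // ltW.
Qed.

Lemma measurable_posterior :
  measurable_fun setT (fun t : p.-tuple R => post (col_of t)).
Proof. exact: measurable_funM. Qed.

Lemma iint_posterior : iint (fun t => (post (col_of t))%:E) = 1%E.
Proof.
rewrite /posterior; have [Z Z0 EZ] := evidence_pos; rewrite EZ.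
have -> : (fun t : p.-tuple R => (prior (col_of t) * lik (col_of t) / fine Z%:E)%:E) =
    (fun t => (Z^-1 * (prior (col_of t) * lik (col_of t)))%:E).
  by apply/funext => t; rewrite [in LHS]mulrC.
rewrite iintZ // ?invr_ge0 ?(ltW Z0) //.
by move: EZ; rewrite /lebRp => ->; rewrite -EFinM mulVf // gt_eqF.
Qed.

Hypothesis ug : gram h \in unitmx.
Local Notation V := (gram h).
Local Notation g := (gauss_density (betahat h) sigma V).

Lemma TV_posterior : TV post g =
  iint (fun t => (Num.max 0 (g (col_of t) - post (col_of t)))%:E).
Proof.
apply: TV_densities.
- exact: posterior_ge0.
- by move=> b; exact/ltW/gauss_density_gt0.
- exact: measurable_posterior.
- exact: measurable_gauss_density.
- exact: iint_posterior.
- exact: iint_gauss_density.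
Qed.

Lemma posterior_gaussE : exists2 Z : R, 0 < Z &
  iint (fun t => (prior (col_of t) * g (col_of t))%:E) = Z%:E /\
  forall b, post b = prior b * g b / Z.
Proof.
have [Z Z0 EZ] := evidence_pos.
have K0 := gauss_cst_gt0 s0 (gram_posdef ug).
set K := gauss_cst _ _ in K0; set l := lik (betahat h).
have l0 : 0 < l by exact: lik_gt0.
have c0 : 0 < K / l by rewrite divr_gt0.
have gE b : g b = K / l * lik b.
  by rewrite (lik_gauss s0 ug b) -/K -/l; field; rewrite !gt_eqF.
exists (K / l * Z); first by rewrite mulr_gt0.
split=> [|b].
  rewrite EFinM -EZ /lebRp -iintZ ?(ltW c0) //; congr iint.
  by apply/funext => t; rewrite gE mulrCA.
rewrite /posterior EZ /= gE; field.
by rewrite !gt_eqF.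
Qed.

Variables (beta0 : 'cV[R]_p) (r eta : R).
Hypothesis r0 : 0 < r.
Hypothesis eta0 : 0 < eta.
Hypothesis eta_le : eta <= prior beta0.
Hypothesis prior_near : forall b : 'cV[R]_p, (forall i, `|b i 0 - beta0 i 0| < 2 * r) ->
  `|prior b - prior beta0| <= eta.
Hypothesis betahat_near : qform 1%:M (betahat h - beta0) <= r ^+ 2.
Hypothesis peak_small : gauss_cst sigma V *
  expR (- (lambda_min V * r ^+ 2) / (sigma ^+ 2 *+ 2)) <= eta.
Hypothesis tail_small : Num.sqrt 2 ^+ p *
  expR (- (lambda_min V * r ^+ 2) / (sigma ^+ 2 *+ 4)) <= eta.

(** [betahat] is within r of beta0, so a point with a coordinate at least 2 r away from that of
    beta0 is at least r away from [betahat]. *)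
Let far (b : 'cV[R]_p) : (exists i, 2 * r <= `|b i 0 - beta0 i 0|) ->
  lambda_min V * r ^+ 2 <= qform V (b - betahat h).
Proof.
move=> [i bi]; apply: le_trans (lambda_min_le _ (gram_sym h)).
have a0 : 0 <= lambda_min V.
  have p0 : (0 < p)%N := leq_ltn_trans (leq0n i) (ltn_ord i).
  have [v v0 [qv _]] := lambda_min_spec (gram_sym h) p0.
  by have := qform_gram_ge0 h v; rewrite qv pmulr_lge0 // qform1_gt0.
apply: ler_wpM2l => //.
have h1 : `|(betahat h) i 0 - beta0 i 0| <= r.
  rewrite -(ler_pXn2r (n := 2)) // ?nnegrE ?(ltW r0) // real_normK ?num_real //.
  by apply: le_trans betahat_near; have := sqr_coord_le_qform1 (betahat h - beta0) i;
    rewrite mxE [(- beta0) i 0]mxE.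
have h2 : r <= `|b i 0 - (betahat h) i 0|.
  have := ler_distD ((betahat h) i 0) (b i 0) (beta0 i 0); lra.
apply: le_trans (sqr_coord_le_qform1 (b - betahat h) i).
rewrite mxE [(- betahat h) i 0]mxE -[leRHS](real_normK (num_real _)).
by rewrite ler_pXn2r ?nnegrE ?(ltW r0).
Qed.

Let s2 := Num.sqrt 2 * sigma.
Let s20 : 0 < s2. Proof. by rewrite mulr_gt0 // sqrtr_gt0. Qed.
Let s2E : s2 ^+ 2 *+ 2 = sigma ^+ 2 *+ 4.
Proof. by rewrite /s2 exprMn sqr_sqrtr // mulr_natl -mulrnA. Qed.
(** Density of N(betahat, 2 sigma^2 V^-1). Dominating g by a small multiple of it away from beta0
    bounds the mass of g there without any tail integral. *)
Let g2 (b : 'cV[R]_p) : R :=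
  gauss_cst s2 V * expR (- qform V (b - betahat h) / (s2 ^+ 2 *+ 2)).

Let g2_ge0 b : 0 <= g2 b.
Proof.
by rewrite mulr_ge0 ?expR_ge0 // ltW // gauss_cst_gt0 //; exact: gram_posdef.
Qed.

Let mg2 : measurable_fun setT (fun t : p.-tuple R => g2 (col_of t)).
Proof.
by apply: measurable_funM => //; exact: measurable_gauss_exp.
Qed.

(** The first bound serves the evidence, where only the mass of the prior is controlled; the second
    serves the tail mass of g. In the second, half of the exponent of g becomes that of [g2], the
    other half supplies the smallness, and sqrt 2 ^ p is the ratio of the normalising constants. *)
Lemma gauss_far (b : 'cV[R]_p) : (exists i, 2 * r <= `|b i 0 - beta0 i 0|) ->
  g b <= eta /\ g b <= eta * g2 b.
Proof.
move=> fb; have pV := gram_posdef ug.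
have qb := far fb.
have K0 := gauss_cst_gt0 s0 pV.
rewrite gauss_densityE //; split.
  apply: le_trans peak_small; rewrite ler_pM2l // ler_expR.
  by rewrite ler_pM2r ?lerN2 // invr_gt0 mulrn_wgt0 // exprn_gt0.
have KE : gauss_cst sigma V = Num.sqrt 2 ^+ p * gauss_cst s2 V.
  have B0 : Num.sqrt 2 ^+ p != 0 :> R by rewrite expf_neq0 // gt_eqF // sqrtr_gt0.
  have sE : Num.sqrt (pi *+ 2) * s2 = Num.sqrt 2 * (Num.sqrt (pi *+ 2) * sigma).
    by rewrite /s2 mulrCA.
  rewrite /gauss_cst sE [in RHS]exprMn.
  have : (Num.sqrt (pi *+ 2) * sigma) ^+ p != 0.
    by rewrite expf_neq0 // gt_eqF // mulr_gt0 // sqrt2pi_gt0.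
  move: (_ ^+ p) (Num.sqrt 2 ^+ p) B0 => a1 a2 B0 A0.
  by field; rewrite B0 A0.
rewrite /g2; set q := qform _ _ in qb *.
have -> : - q / (sigma ^+ 2 *+ 2) = - q / (sigma ^+ 2 *+ 4) + - q / (s2 ^+ 2 *+ 2).
  rewrite s2E; field.
  by rewrite gt_eqF.
rewrite expRD KE mulrACA.
apply: ler_wpM2r; first exact: g2_ge0.
apply: le_trans tail_small; rewrite ler_wpM2l ?exprn_ge0 ?sqrtr_ge0 // ler_expR.
by rewrite ler_pM2r ?lerN2 // invr_gt0 mulrn_wgt0 // exprn_gt0.
Qed.

Let near_far (b : 'cV[R]_p) : (forall i, `|b i 0 - beta0 i 0| < 2 * r) \/
  (exists i, 2 * r <= `|b i 0 - beta0 i 0|).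
Proof.
have [/forallP nb|] := boolP [forall i, `|b i 0 - beta0 i 0| < 2 * r]; first by left.
by rewrite negb_forall => /existsP[i]; rewrite -leNgt; right; exists i.
Qed.

Lemma TV_posterior_le : (TV post g <= (3 * eta / prior beta0 + eta)%:E)%E.
Proof.
have mg := measurable_gauss_density s0 ug.
have g0 b : 0 <= g b by exact/ltW/gauss_density_gt0.
have g1 := iint_gauss_density s0 ug.
set pi0 := prior beta0; have pi0_gt0 : 0 < pi0 := lt_le_trans eta0 eta_le.
have [Z Z0 [ZE postE]] := posterior_gaussE.
have ZleE : Z <= pi0 + 2 * eta.
  rewrite -lee_fin -ZE.
  (* Near beta0 the first summand dominates prior * g, elsewhere the second does. *)
  apply: (@le_trans _ _ (iint (fun t : p.-tuple R =>
    ((pi0 + eta) * g (col_of t) + eta * prior (col_of t))%:E))).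
    apply: iint_le => [t|||t].
    - by rewrite mulr_ge0.
    - exact: measurable_funM.
    - by apply: measurable_funD; exact: measurable_funM.
    have [nb|fb] := near_far (col_of t).
      have := prior_near nb; rewrite ler_norml => /andP[_ pb].
      apply: ler_wpDr; first by rewrite mulr_ge0 // ltW.
      by apply: ler_wpM2r => //; rewrite -lerBlDl.
    have [gb _] := gauss_far fb.
    apply: ler_wpDl; first by rewrite mulr_ge0 // addr_ge0 // ltW.
    by rewrite mulrC ler_wpM2r.
  rewrite iint_lin ?addr_ge0 ?(ltW eta0) ?(ltW pi0_gt0) //.
  by move: prior1; rewrite /lebRp g1 => ->; rewrite !mule1 -EFinD lee_fin; lra.
rewrite TV_posterior.
(* Near beta0 the factor 1 - prior / Z is at most 3 eta / pi0; elsewhere the posterior is dropped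
   and g is compared with [g2]. *)
apply: (@le_trans _ _ (iint (fun t : p.-tuple R =>
  (3 * eta / pi0 * g (col_of t) + eta * g2 (col_of t))%:E))).
  apply: iint_le => [t|||t].
  - by rewrite le_max lexx.
  - apply: measurable_maxr => //; apply: measurable_funB => //.
    exact: measurable_posterior.
  - by apply: measurable_funD; exact: measurable_funM.
  set b := col_of t.
  have c0 : 0 <= 3 * eta / pi0 by rewrite divr_ge0 ?mulr_ge0 // ltW.
  rewrite ge_max; apply/andP; split.
    apply: addr_ge0; first exact: mulr_ge0.
    exact: mulr_ge0 (ltW eta0) (g2_ge0 b).
  have [nb|fb] := near_far b.
    apply: ler_wpDr; first by rewrite mulr_ge0 // ltW.
    have := prior_near nb; rewrite ler_norml => /andP[pb _].
    have -> : g b - post b = (1 - prior b / Z) * g b.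
      by rewrite postE; field; rewrite gt_eqF.
    apply: ler_wpM2r => //.
    have : (pi0 - eta) / (pi0 + 2 * eta) <= prior b / Z.
      (* [eta_le] makes the numerator pi0 - eta nonnegative. *)
      apply: ler_pM; [by rewrite subr_ge0|by rewrite invr_ge0; lra| |].
        by rewrite -/pi0 in pb; lra.
      by rewrite lef_pV2 ?posrE //; lra.
    have -> : (pi0 - eta) / (pi0 + 2 * eta) = 1 - 3 * eta / (pi0 + 2 * eta).
      by field; rewrite gt_eqF //; lra.
    have : 3 * eta / (pi0 + 2 * eta) <= 3 * eta / pi0.
      apply: ler_wpM2l; first by rewrite mulr_ge0 // ltW.
      rewrite lef_pV2 ?posrE ?addr_gt0 ?mulr_gt0 //.
      by rewrite lerDl mulr_ge0 // ltW.
    lra.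
  have [_ gb] := gauss_far fb.
  apply: ler_wpDl; first by rewrite mulr_ge0.
  by apply: le_trans gb; rewrite gerBl posterior_ge0.
rewrite (@iint_lin _ p _ _ (fun t => g (col_of t)) (fun t => g2 (col_of t))) //;
  last 2 first.
- by rewrite divr_ge0 ?mulr_ge0 // ltW.
- by rewrite ltW.
rewrite g1 (@iint_gauss _ p s2 V (betahat h) s20 (gram_posdef ug)).
by rewrite !mule1.
Qed.

End one_history.
End posterior_density.

(** * Consistency of the least squares estimator *)

Lemma measurable_iint {R : realType} d (T : measurableType d) p
    (q : T -> p.-tuple R -> R) : (forall w t, 0 <= q w t) ->
  measurable_fun setT (fun z : T * p.-tuple R => q z.1 z.2) ->
  measurable_fun setT (fun w => iint (fun t => (q w t)%:E)).
Proof.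
move=> q0 mq.
have -> : (fun w => iint (fun t => (q w t)%:E)) =
    fun w => (\int[lebtuple p]_t (q w t)%:E)%E.
  apply/funext => w; rewrite iint_real //.
  by apply: (measurableT_comp mq (g := fun t => (w, t))); exact: measurable_fun_pair.
have mq' : measurable_fun setT (fun z : T * p.-tuple R => (q z.1 z.2)%:E).
  exact/measurable_EFinP.
apply: (@measurable_fun_fubini_tonelli_F _ _ _ _ _ (lebtuple p) _ mq').
by move=> z; rewrite lee_fin.
Qed.

Section mixture.
Context {R : realType} (p : nat) (sigma : R) (beta0 : 'cV[R]_p).
Hypothesis s0 : 0 < sigma.

Lemma posdef1 : posdef (1%:M : 'M[R]_p).
Proof. by split=> [|v v0]; [rewrite trmx1|exact: qform1_gt0]. Qed.

(** Scaling the covariance by the noise variance gives both exponents the denominator 2 sigma^2, so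
    that they combine into a form in V + I. *)
Definition mixing_density (t : p.-tuple R) : R :=
  gauss_cst sigma (1%:M : 'M[R]_p) *
  expR (- qform 1%:M (col_of t - beta0) / (sigma ^+ 2 *+ 2)).

(** The Bayes factor of a N(beta0, sigma^2 I) coefficient vector against beta0. *)
Definition mixture n (h : hist R p n) : \bar R :=
  iint (fun t => (mixing_density t *
                  (lik sigma h (col_of t) / lik sigma h beta0))%:E).

Lemma mixing_density_ge0 t : 0 <= mixing_density t.
Proof.
rewrite mulr_ge0 ?expR_ge0 // ltW // gauss_cst_gt0 //; exact: posdef1.
Qed.

Lemma measurable_mixing_density : measurable_fun setT mixing_density.
Proof. by apply: measurable_funM => //; exact: measurable_gauss_exp. Qed.

Section joint.
Context d (T : measurableType d) n (H : T -> hist R p n).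
Hypothesis mH : measurable_fun setT H.

Let integrand w t :=
  mixing_density t * (lik sigma (H w) (col_of t) / lik sigma (H w) beta0).

Lemma mixture_integrand_ge0 w t : 0 <= integrand w t.
Proof.
by rewrite mulr_ge0 ?mixing_density_ge0 // divr_ge0 // ltW // lik_gt0.
Qed.

Lemma measurable_mixture_integrand :
  measurable_fun setT (fun z : T * p.-tuple R => integrand z.1 z.2).
Proof.
apply: measurable_funM.
  exact: (measurableT_comp measurable_mixing_density measurable_snd).
have mHf : measurable_fun setT (fun z : T * p.-tuple R => H z.1).
  exact: (measurableT_comp mH measurable_fst).
have -> : (fun z : T * p.-tuple R =>
    lik sigma (H z.1) (col_of z.2) / lik sigma (H z.1) beta0) =
  fun z => lik sigma (H z.1) (col_of z.2) * expR (- ln (lik sigma (H z.1) beta0)).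
  by apply/funext => z; rewrite expRN lnK // posrE lik_gt0.
apply: measurable_funM; first exact: measurable_lik.
apply: measurableT_comp => //; apply: measurableT_comp => //.
by apply: measurableT_comp => //; exact: measurable_lik_cst.
Qed.

Lemma measurable_mixture : measurable_fun setT (fun w => mixture (H w)).
Proof.
apply: (@measurable_iint _ _ _ _ integrand); first exact: mixture_integrand_ge0.
exact: measurable_mixture_integrand.
Qed.

Lemma mixture_mean (P : probability T R) :
  (forall b, \int[P]_w (lik sigma (H w) b / lik sigma (H w) beta0)%:E = 1)%E ->
  (\int[P]_w mixture (H w) = 1)%E.
Proof.
move=> ratio1.
have mq : measurable_fun setT (fun z : T * p.-tuple R => (integrand z.1 z.2)%:E).
  by apply/measurable_EFinP; exact: measurable_mixture_integrand.
have mw w : measurable_fun setT (integrand w).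
  by apply: (measurableT_comp measurable_mixture_integrand (g := fun t => (w, t)));
    exact: measurable_fun_pair.
have mt t : measurable_fun setT (integrand ^~ t).
  by apply: (measurableT_comp measurable_mixture_integrand (g := fun w => (w, t)));
    exact: measurable_fun_pair.
transitivity (\int[P]_w \int[lebtuple p]_t (integrand w t)%:E)%E.
  apply: eq_integral => w _; rewrite /mixture -iint_real // => t.
  exact: mixture_integrand_ge0.
rewrite (@fubini_tonelli _ _ _ _ _ P (lebtuple p) _ mq) /=; last first.
  by move=> z; rewrite lee_fin mixture_integrand_ge0.
rewrite -(@iint_gauss _ p sigma 1%:M beta0 s0 posdef1).
rewrite (@iint_real _ p mixing_density mixing_density_ge0 measurable_mixing_density).
apply: eq_integral => t _.
have rho0 := mixing_density_ge0 t.
transitivity (\int[P]_w ((mixing_density t)%:E *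
    (lik sigma (H w) (col_of t) / lik sigma (H w) beta0)%:E))%E.
  by apply: eq_integral => w _; rewrite -EFinM.
rewrite ge0_integralZl //=.
- by rewrite ratio1 mule1.
- apply/measurable_EFinP.
  have -> : (fun w => lik sigma (H w) (col_of t) / lik sigma (H w) beta0) =
    fun w => lik sigma (H w) (col_of t) * expR (- ln (lik sigma (H w) beta0)).
    by apply/funext => z; rewrite expRN lnK // posrE lik_gt0.
  apply: measurable_funM; first exact: measurable_lik.
  apply: measurableT_comp => //; apply: measurableT_comp => //.
  by apply: measurableT_comp => //; exact: measurable_lik_cst.
- by move=> w _; rewrite lee_fin divr_ge0 // ltW // lik_gt0.
Qed.

Lemma mixture_ge0 w : (0 <= mixture (H w))%E.
Proof.
apply: iint_ge0 => [t|]; first exact: mixture_integrand_ge0.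
by apply: (measurableT_comp measurable_mixture_integrand (g := fun t => (w, t)));
  exact: measurable_fun_pair.
Qed.

Lemma mixture_markov (P : probability T R) (delta : R) : 0 < delta ->
  (\int[P]_w mixture (H w) = 1)%E ->
  measurable [set w | (delta^-1%:E < mixture (H w))%E] /\
  (P [set w | (delta^-1%:E < mixture (H w))%E] <= delta%:E)%E.
Proof.
move=> d0 m1; set E := [set w | _].
have mE : measurable E.
  rewrite /E -[X in measurable X]setTI.
  exact: (emeasurable_fun_o_infty measurableT measurable_mixture).
split=> //.
have : (\int[P]_w (delta^-1%:E * (\1_E w)%:E) <= 1)%E.
  rewrite -m1; apply: ge0_le_integral => //.
  - by move=> w _; rewrite mule_ge0 // lee_fin ?invr_ge0 ?(ltW d0) // indicE.
  - by apply: measurable_funeM; apply/measurable_EFinP; exact: measurable_indic.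
  - exact: measurable_mixture.
  move=> w _; rewrite indicE; case: (boolP (w \in E)) => wE.
    by rewrite mule1; move: wE; rewrite inE => /ltW.
  by rewrite mule0 mixture_ge0.
have -> : (\int[P]_w (delta^-1%:E * (\1_E w)%:E) = delta^-1%:E * P E)%E.
  rewrite ge0_integralZl ?integral_indic ?setIT //.
  - by apply/measurable_EFinP; exact: measurable_indic.
  - by rewrite lee_fin invr_ge0 ltW.
by rewrite muleC lee_pdivrMr // mul1e.
Qed.

End joint.

Section one_history.
Context (n : nat) (h : hist R p n).
Hypothesis ug : gram h \in unitmx.
Local Notation V := (gram h).
Local Notation u := (betahat h - beta0).

Hypothesis lmin1 : 1 <= lambda_min V.

Lemma posdefD1 : posdef (V + 1%:M).
Proof.
split=> [|v v0]; first by rewrite linearD /= gram_sym trmx1.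
rewrite /qform bform_add ltr_wpDl ?qform_gram_ge0 //.
exact: qform1_gt0.
Qed.

Lemma mixture_lower :
  ((expR (qform V u / (sigma ^+ 2 *+ 4)) / Num.sqrt (\det (V + 1%:M)))%:E
   <= mixture h)%E.
Proof.
set W := V + 1%:M; have pW : posdef W := posdefD1; have sV := gram_sym h.
have sW : W^T = W by case: pW.
have Wu := posdef_unitmx pW.
(* The centre, relative to beta0, that completes the square: W m = V u. *)
pose m := invmx W *m (V *m u).
have bWm z : bform W z m = bform V z u.
  by rewrite /bform -mulmxA /m mulKVmx // mulmxA.
have qW z : qform W z = qform V z + qform 1%:M z by rewrite /qform bform_add.
set Q := qform V u.
have Q_ge : qform 1%:M u <= Q.
  apply: le_trans (lambda_min_le u sV).
  by rewrite ler_peMl // qform1_ge0.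
have c_ge : Q / 2 <= qform W m.
  (* The form W at m - u / 2 is q_W(m) - Q + q_W(u) / 4, and q_W(u) <= 2 Q because lambda_min V >=
     1. The factor 2 lost here is why the exponent has 4 in place of 2. *)
  have := posdef_qform_ge0 (m + (- 2^-1) *: u) pW.
  rewrite qformD // bformZr qformZ (bformC m u sW) bWm -/(qform V u) -/Q (qW u) -/Q.
  have -> : (- 2^-1) ^+ 2 = 4^-1 :> R by field.
  lra.
(* With z = b - beta0, this is |z|^2 + q_V(z - u) - q_V(u) = q_W(z - m) - q_W(m). *)
have expE b : mixing_density b * (lik sigma h (col_of b) / lik sigma h beta0) =
    gauss_cst sigma (1%:M : 'M[R]_p) * expR (qform W m / (sigma ^+ 2 *+ 2)) *
    expR (- qform W (col_of b - (beta0 + m)) / (sigma ^+ 2 *+ 2)).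
  rewrite /mixing_density (lik_betahat sigma ug (col_of b)).
  rewrite (lik_betahat sigma ug beta0).
  set l := lik _ _ _; have l0 : l != 0 by rewrite gt_eqF // lik_gt0.
  have -> : col_of b - betahat h = (col_of b - beta0) - u.
    by rewrite opprB addrA subrK.
  have -> : col_of b - (beta0 + m) = (col_of b - beta0) - m.
    by rewrite opprD addrA.
  have -> : qform V (beta0 - betahat h) = Q by rewrite -qformN opprB.
  set z := col_of b - beta0.
  rewrite -mulf_div divff // mul1r -expRN.
  move: (gauss_cst _ _) => K; rewrite -!mulrA -!expRD; congr (_ * expR _).
  rewrite (qformD z (- u) sV) (qformD z (- m) sW) !bformNr !qformN bWm (qW z) -/Q.
  field.
  by rewrite gt_eqF.
rewrite /mixture; under [X in iint X]eq_fun do rewrite expE.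
rewrite iint_gaussian //; last first.
  by rewrite mulr_ge0 ?expR_ge0 // ltW // gauss_cst_gt0 //; exact: posdef1.
rewrite lee_fin /gauss_cst det1 sqrtr1.
have A0 : (Num.sqrt (pi *+ 2) * sigma) ^+ p != 0.
  by rewrite expf_neq0 // gt_eqF // mulr_gt0 // sqrt2pi_gt0.
move: (_ ^+ p) A0 => a0 A0.
have -> : 1 / a0 * expR (qform W m / (sigma ^+ 2 *+ 2)) * (a0 / Num.sqrt (\det W)) =
  expR (qform W m / (sigma ^+ 2 *+ 2)) / Num.sqrt (\det W).
  by field; rewrite A0 gt_eqF // sqrtr_gt0 posdef_det_gt0.
apply: ler_wpM2r; first by rewrite invr_ge0 sqrtr_ge0.
rewrite ler_expR.
have -> : Q / (sigma ^+ 2 *+ 4) = (Q / 2) / (sigma ^+ 2 *+ 2).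
  by field; rewrite gt_eqF.
by rewrite ler_pM2r // invr_gt0 mulrn_wgt0 // exprn_gt0.
Qed.

Lemma sqrt_expR (x : R) : Num.sqrt (expR x) = expR (x / 2).
Proof.
have -> : expR x = expR (x / 2) ^+ 2.
  by rewrite expr2 -expRD; congr expR; lra.
by rewrite sqrtr_sqr ger0_norm // expR_ge0.
Qed.

Lemma det_sqrt_le (W : 'M[R]_p) (L : R) : 0 < L -> posdef W ->
  (forall v, qform W v <= L * qform 1%:M v) ->
  Num.sqrt (\det W) <= expR (p%:R / 2 * ln L).
Proof.
move=> L0 pW WL; have -> : p%:R / 2 * ln L = (p%:R * ln L) / 2 by lra.
rewrite -sqrt_expR expRM_natl lnK ?posrE //.
by rewrite ler_wsqrtr // posdef_det_le.
Qed.

Hypothesis p0 : (0 < p)%N.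

Lemma betahat_close (delta : R) : 0 < delta -> (mixture h <= delta^-1%:E)%E ->
  lambda_min V * qform 1%:M u <=
  sigma ^+ 2 *+ 4 * (- ln delta + p%:R / 2 * (ln 2 + ln (lambda_max V))).
Proof.
move=> d0 mh; have sV := gram_sym h.
have L1 : 1 <= lambda_max V by apply: le_trans lmin1 _; exact: lambda_min_le_max.
have L0 : 0 < lambda_max V by exact: lt_le_trans L1.
apply: le_trans (lambda_min_le u sV) _.
have := le_trans mixture_lower mh; rewrite lee_fin.
have pW := posdefD1.
have sd0 : 0 < Num.sqrt (\det (V + 1%:M)) by rewrite sqrtr_gt0 posdef_det_gt0.
rewrite ler_pdivrMr // => h1.
(* As a form, V + I is at most 1 + lambda_max, hence at most 2 lambda_max since lambda_max >= 1. *)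
have h2 : Num.sqrt (\det (V + 1%:M)) <= expR (p%:R / 2 * ln (2 * lambda_max V)).
  apply: det_sqrt_le => //; first by rewrite mulr_gt0.
  move=> v; rewrite /qform bform_add -/(qform V v) -/(qform 1%:M v).
  have := lambda_max_ge v sV; have := qform1_ge0 v.
  move: (qform 1%:M v) (qform V v) (lambda_max V) L1 => a b L L1.
  nra.
have h3 : expR (qform V u / (sigma ^+ 2 *+ 4)) <=
    expR (- ln delta + p%:R / 2 * (ln 2 + ln (lambda_max V))).
  rewrite expRD expRN lnK ?posrE // -lnM ?posrE //.
  apply: le_trans h1 _; apply: ler_wpM2l => //; by rewrite invr_ge0 ltW.
move: h3; rewrite ler_expR ler_pdivrMr ?mulrn_wgt0 ?exprn_gt0 //.
by rewrite [X in _ -> _ <= X]mulrC.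
Qed.

End one_history.
End mixture.

(** * The bound on a good event *)

(** A Gram matrix is positive semidefinite, so invertible means positive definite. This turns
    invertibility into a condition on a measurable eigenvalue. *)
Lemma lambda_min_gram_gt0 {R : realType} p n (h : hist R p n) : (0 < p)%N ->
  (0 < lambda_min (gram h)) = (gram h \in unitmx).
Proof.
move=> p0; apply/idP/idP => [l0|ug].
  apply: posdef_unitmx; split=> [|v v0]; first exact: gram_sym.
  apply: lt_le_trans (lambda_min_le v (gram_sym h)).
  by rewrite mulr_gt0 // qform1_gt0.
have [v v0 [qv _]] := lambda_min_spec (gram_sym h) p0.
have [_ /(_ v v0)] := gram_posdef ug.
by rewrite qv pmulr_lgt0 // qform1_gt0.
Qed.

Lemma expRN_le_inv {R : realType} (x : R) : 0 < x -> expR (- x) <= x^-1.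
Proof.
move=> x0; rewrite expRN lef_pV2 ?posrE ?expR_gt0 //.
by apply: le_trans (expR_ge1Dx x); rewrite lerDr.
Qed.

(** * Measurability of the total variation distance *)

Section posterior_measurability.
Context {R : realType} (p : nat) (sigma : R) (prior : 'cV[R]_p -> R).
Hypothesis s0 : 0 < sigma.
Hypothesis prior0 : forall b, 0 <= prior b.
Hypothesis cprior : continuous prior.
Hypothesis prior1 : lebRp (fun b => (prior b)%:E) = 1%E.

(* A jointly measurable expression for the total variation distance, valid
   when the Gram matrix is invertible; [x * expR (- ln c)] is [x / c] there. *)
Definition TV_formula n (h : hist R p n) : \bar R :=
  iint (fun t => (Num.max 0
    (lik sigma h (col_of t) *
       expR (- ln (fine (iint (fun u => (lik sigma h (col_of u))%:E)))) -
     prior (col_of t) * lik sigma h (col_of t) *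
       expR (- ln (fine (iint (fun u =>
         (prior (col_of u) * lik sigma h (col_of u))%:E))))))%:E).

(** Both terms are normalised likelihoods: the Gaussian is the posterior for a flat prior, since the
    likelihood is a multiple of its density. *)
Lemma TV_formulaE n (h : hist R p n) : gram h \in unitmx ->
  TV (posterior prior sigma h)
     (gauss_density (betahat h) sigma (gram h)) = TV_formula h.
Proof.
move=> ug; rewrite (TV_posterior s0 prior0 cprior prior1 ug); congr iint.
apply/funext => t; congr (Num.max 0 (_ - _))%:E; last first.
  have [Z Z0 EZ] := evidence_pos sigma prior0 cprior prior1 h.
  by move: EZ; rewrite /posterior /lebRp => ->; rewrite /= expRN lnK // posrE.
set g := gauss_density _ _ _; set K := gauss_cst sigma (gram h).
set l := lik sigma h (betahat h).
have K0 : 0 < K := gauss_cst_gt0 s0 (gram_posdef ug).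
have l0 : 0 < l by exact: lik_gt0.
have -> : iint (fun u : p.-tuple R => (lik sigma h (col_of u))%:E) = (l / K)%:E.
  under [X in iint X]eq_fun do rewrite (lik_gauss s0 ug) -/g -/K -/l.
  rewrite (@iintZ _ p _ (fun u => g (col_of u))); first last.
  - exact: measurable_gauss_density.
  - by move=> u; exact/ltW/gauss_density_gt0.
  - by rewrite divr_ge0 // ltW.
  by rewrite iint_gauss_density // mule1.
have lK0 : 0 < l / K by rewrite divr_gt0.
rewrite /= expRN lnK ?posrE //.
have -> : lik sigma h (col_of t) = l / K * g (col_of t) by exact: lik_gauss.
by field; rewrite !gt_eqF.
Qed.

Lemma measurable_TV_formula d (T : measurableType d) n (H : T -> hist R p n) :
  measurable_fun setT H -> measurable_fun setT (fun w => TV_formula (H w)).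
Proof.
move=> mH.
have mprior := measurable_continuous_col cprior.
have mHf : measurable_fun setT (fun z : T * p.-tuple R => H z.1).
  exact: (measurableT_comp mH measurable_fst).
have ml : measurable_fun setT
    (fun z : T * p.-tuple R => lik sigma (H z.1) (col_of z.2)).
  exact: measurable_lik.
have mpr : measurable_fun setT (fun z : T * p.-tuple R => prior (col_of z.2)).
  exact: (measurableT_comp mprior measurable_snd).
have mpl := measurable_funM mpr ml.
have norm (q : T -> p.-tuple R -> R) : (forall w t, 0 <= q w t) ->
    measurable_fun setT (fun z : T * p.-tuple R => q z.1 z.2) ->
    measurable_fun setT (fun z : T * p.-tuple R =>
      expR (- ln (fine (iint (fun u => (q z.1 u)%:E))))).
  move=> q0 mq; apply: measurableT_comp => //; apply: measurableT_comp => //.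
  apply: measurableT_comp => //.
  apply: (measurableT_comp (@fine_measurable R setT measurableT)).
  exact: (measurableT_comp (measurable_iint q0 mq) measurable_fst).
apply: (@measurable_iint _ _ _ _ (fun w t => Num.max 0 _)) => [w t|].
  by rewrite le_max lexx.
apply: measurable_maxr => //; apply: measurable_funB; apply: measurable_funM => //.
- apply: (norm (fun w u => lik sigma (H w) (col_of u))) => // w t.
  exact/ltW/lik_gt0.
- apply: (norm (fun w u => prior (col_of u) * lik sigma (H w) (col_of u))) => // w t.
  by rewrite mulr_ge0 //; exact/ltW/lik_gt0.
Qed.

End posterior_measurability.

(** * Thresholds that force a small distance *)

Section deterministic_bound.
Context {R : realType} (p : nat) (sigma : R) (prior : 'cV[R]_p -> R).
Context (beta0 : 'cV[R]_p).
Hypothesis p0 : (0 < p)%N.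
Hypothesis s0 : 0 < sigma.
Hypothesis prior0 : forall b, 0 <= prior b.
Hypothesis cprior : continuous prior.
Hypothesis prior1 : lebRp (fun b => (prior b)%:E) = 1%E.
Hypothesis prior_pos : 0 < prior beta0.

(** The thresholds depend neither on n nor on the history, so probability enters only through the
    three conditions. [0 <= M] lets the first condition imply that the Gram matrix is invertible. *)
Lemma TV_small_on_good_event (eps delta : R) : 0 < eps -> 0 < delta ->
  exists M e1 : R, [/\ 0 <= M, 0 < e1 & forall n (h : hist R p n),
    M < lambda_min (gram h) ->
    `|ln (lambda_max (gram h))| <= e1 * `|lambda_min (gram h)| ->
    (mixture sigma beta0 h <= delta^-1%:E)%E ->
    (TV (posterior prior sigma h)
       (gauss_density (betahat h) sigma (gram h)) <= eps%:E)%E].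
Proof.
move=> eps0 d0; set pi0 := prior beta0.
(* The second entry is chosen to give 3 eta / pi0 + eta <= eps. *)
pose eta := Num.min pi0 (eps / (3 / pi0 + 1)).
have c31 : 0 < 3 / pi0 + 1 by rewrite addr_gt0 // divr_gt0.
have eta0 : 0 < eta by rewrite lt_min prior_pos divr_gt0.
have eta_pi0 : eta <= pi0 by rewrite ge_min lexx.
have eta_eps : 3 * eta / pi0 + eta <= eps.
  have : eta <= eps / (3 / pi0 + 1) by rewrite ge_min lexx orbT.
  rewrite ler_pdivlMr // mulrDr mulr1; apply: le_trans.
  by rewrite le_eqVlt; apply/orP; left; apply/eqP; rewrite mulrA [eta * 3]mulrC.
have [r r0 nearr] : exists2 r, 0 < r & forall b : 'cV[R]_p,
    (forall i, `|b i 0 - beta0 i 0| < 2 * r) -> `|prior b - pi0| <= eta.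
  have : \forall b \near beta0, `|prior beta0 - prior b| < eta.
    have /cvgrPdist_lt := @cprior beta0.
    by apply.
  move=> /nbhs_ballP[e /= e0 eP]; exists (e / 2); first by rewrite divr_gt0.
  move=> b hb; rewrite distrC; apply/ltW/eP; split=> // i j.
  rewrite (ord1 j) /ball /= distrC.
  by have := hb i; rewrite mulrC divfK.
have rr : 0 < r ^+ 2 by rewrite exprn_gt0.
have ss : 0 < sigma ^+ 2 by rewrite exprn_gt0.
have pR : 0 < p%:R :> R by rewrite ltr0n.
set A := (Num.sqrt (pi *+ 2) * sigma) ^+ p.
have A0 : 0 < A by rewrite exprn_gt0 // mulr_gt0 // sqrt2pi_gt0.
set B := Num.sqrt 2 ^+ p : R.
have B0 : 0 < B by rewrite exprn_gt0 // sqrtr_gt0.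
pose C := - ln delta + p%:R / 2 * ln 2 : R.
(* [e1] limits p / 2 * ln lambda_max to lambda_min * r^2 / (8 sigma^2). Below, [x2] absorbs the
   constant [C] in the bound on betahat - beta0, [x3] serves the peak height and [x4] the tail
   mass. *)
pose e1 := r ^+ 2 / (4 * sigma ^+ 2 * p%:R).
pose x3 := 4 * sigma ^+ 2 * A^-1 / (r ^+ 2 * eta).
pose x4 := 4 * sigma ^+ 2 * B / (r ^+ 2 * eta).
pose x2 := 8 * sigma ^+ 2 * `|C| / r ^+ 2.
have x20 : 0 <= x2 by rewrite divr_ge0 ?mulr_ge0 // ltW.
have x30 : 0 < x3 by rewrite divr_gt0 ?mulr_gt0 ?invr_gt0.
have x40 : 0 < x4 by rewrite divr_gt0 ?mulr_gt0.
exists (1 + x2 + x3 + x4), e1; split; first by lra.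
  by rewrite divr_gt0 ?mulr_gt0.
move=> n h; set V := gram h; set a := lambda_min V; set L := lambda_max V.
move=> Ma lnL mh.
have a1 : 1 <= a by lra.
have a0 : 0 < a by lra.
have ug : V \in unitmx by rewrite -lambda_min_gram_gt0.
have L0 : 0 < L.
  by apply: lt_le_trans a0 _; apply: lambda_min_le_max => //; exact: gram_sym.
have {}lnL : ln L <= e1 * a.
  by rewrite (le_trans (ler_norm _)) // -[a in leRHS]gtr0_norm.
have pe1 : p%:R / 2 * (e1 * a) = a * (r ^+ 2 / (8 * sigma ^+ 2)).
  by rewrite /e1; field; rewrite !gt_eqF.
have plnL : p%:R / 2 * ln L <= a * (r ^+ 2 / (8 * sigma ^+ 2)).
  by rewrite -pe1 ler_pM2l // divr_gt0.
(* Rests on exp (- y) <= 1 / y; used with c = A^-1 for the peak and c = B for the tail mass. *)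
have tail (c x : R) : 0 < c -> x = 4 * sigma ^+ 2 * c / (r ^+ 2 * eta) -> x <= a ->
    c * expR (- (a * r ^+ 2 / (sigma ^+ 2 *+ 4))) <= eta.
  move=> c0 xE xa.
  have y0 : 0 < a * r ^+ 2 / (sigma ^+ 2 *+ 4).
    by rewrite divr_gt0 ?mulr_gt0 // mulrn_wgt0.
  apply: le_trans (_ : c * (a * r ^+ 2 / (sigma ^+ 2 *+ 4))^-1 <= _).
    by rewrite ler_pM2l // expRN_le_inv.
  rewrite ler_pdivrMr // -ler_pdivrMl //.
  apply: le_trans (_ : x * (r ^+ 2 / (sigma ^+ 2 *+ 4)) <= _).
    rewrite xE le_eqVlt; apply/orP; left; apply/eqP; field.
    by rewrite !gt_eqF.
  by rewrite -mulrA ler_wpM2r // divr_ge0 ?mulrn_wge0 // ltW.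
apply: le_trans (_ : (3 * eta / pi0 + eta)%:E <= _)%E; last by rewrite lee_fin.
apply: (@TV_posterior_le _ _ _ _ s0 prior0 cprior prior1 _ h ug beta0 r eta) => //.
- have := betahat_close s0 ug a1 p0 d0 mh; rewrite -/V -/a -/L => bc.
  rewrite -(ler_pM2l a0); apply: le_trans bc _.
  have -> : - ln delta + p%:R / 2 * (ln 2 + ln L) = C + p%:R / 2 * ln L.
    by rewrite /C; ring.
  apply: le_trans (_ : sigma ^+ 2 *+ 4 * (`|C| + a * (r ^+ 2 / (8 * sigma ^+ 2))) <= _).
    by rewrite ler_pM2l ?mulrn_wgt0 // lerD // ler_norm.
  (* Each of the two terms has a budget of a * r^2 / 2. *)
  have -> : sigma ^+ 2 *+ 4 * (`|C| + a * (r ^+ 2 / (8 * sigma ^+ 2))) =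
     x2 * (r ^+ 2 / 2) + a * (r ^+ 2 / 2).
    by rewrite /x2; field; rewrite !gt_eqF.
  have : x2 * (r ^+ 2 / 2) <= a * (r ^+ 2 / 2).
    by rewrite ler_pM2r ?divr_gt0 //; lra.
  lra.
- rewrite -/V -/a.
  have VL : Num.sqrt (\det V) <= expR (p%:R / 2 * ln L).
    apply: det_sqrt_le => //; first exact: gram_posdef.
    by move=> v; apply: lambda_max_ge; exact: gram_sym.
  apply: le_trans (tail A^-1 x3 _ _ _); last 3 first.
  + by rewrite invr_gt0.
  + by [].
  + by lra.
  rewrite /gauss_cst -/A mulrAC [A^-1 * _]mulrC ler_pM2r ?invr_gt0 //.
  apply: le_trans (_ : expR (p%:R / 2 * ln L) *
      expR (- (a * r ^+ 2) / (sigma ^+ 2 *+ 2)) <= _).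
    by rewrite ler_pM2r ?expR_gt0.
  rewrite -expRD ler_expR.
  (* In units of a * r^2 / (8 sigma^2), the determinant adds at most 1 to the exponent, the
     quadratic form contributes -4, and [tail] asks for -2. *)
  have -> : - (a * r ^+ 2 / (sigma ^+ 2 *+ 4)) =
    a * (r ^+ 2 / (8 * sigma ^+ 2)) - a * (3 * r ^+ 2 / (8 * sigma ^+ 2)).
    by field; rewrite gt_eqF.
  have -> : - (a * r ^+ 2) / (sigma ^+ 2 *+ 2) =
    - a * (3 * r ^+ 2 / (8 * sigma ^+ 2)) - a * (r ^+ 2 / (8 * sigma ^+ 2)).
    by field; rewrite gt_eqF.
  have : 0 <= a * (r ^+ 2 / (8 * sigma ^+ 2)).
    by rewrite mulr_ge0 ?(ltW a0) // divr_ge0 ?mulr_ge0 // ltW.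
  lra.
- rewrite -/V -/a -/B.
  have -> : - (a * r ^+ 2) / (sigma ^+ 2 *+ 4) = - (a * r ^+ 2 / (sigma ^+ 2 *+ 4)).
    by rewrite mulNr.
  by apply: (tail B x4) => //; lra.
Qed.

End deterministic_bound.

(** * Convergence in probability *)

Lemma cvge0P {R : realType} (u : nat -> \bar R) : (forall n, (0 <= u n)%E) ->
  u @ \oo --> 0%E <->
  forall e : R, 0 < e -> \forall n \near \oo, (u n <= e%:E)%E.
Proof.
move=> u0; split=> [/fine_cvgP[fu cu] e e0|ue].
  have /cvgr0Pnorm_le/(_ _ e0) := cu.
  apply: filterS2 fu => n fn /=.
  rewrite ger0_norm ?fine_ge0 // => ne.
  by rewrite -(fineK fn) lee_fin.
apply/fine_cvgP; split.
  apply: filterS (ue _ ltr01) => n un.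
  by rewrite ge0_fin_numE // (le_lt_trans un) // ltry.
apply/cvgr0Pnorm_le => e e0; apply: filterS (ue _ e0) => n un /=.
have fn : u n \is a fin_num by rewrite ge0_fin_numE // (le_lt_trans un) // ltry.
by rewrite ger0_norm ?fine_ge0 // -lee_fin fineK.
Qed.

(** There is no eigenvalue, and the infimum of the empty set is 0 by convention. *)
Lemma lambda_min_dim0 {R : realType} (A : 'M[R]_0) : lambda_min A = 0.
Proof.
rewrite /lambda_min (_ : [set a | _] = set0) ?inf0 //.
apply/seteqP; split => // a /= /eigenvalueP[v _ /negP[]].
by apply/eqP/rowP => -[].
Qed.

Theorem theorem1 (R : realType) (p : nat) (sigma : R) (beta0 : 'cV[R]_p)
  (Lambda : forall j : nat, R.-pker (hist R p j) ~> p.-tuple R)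
  (prior : 'cV[R]_p -> R)
  (d : measure_display) (Omega : measurableType d) (P : probability Omega R)
  (X : nat -> Omega -> p.-tuple R) (Y : nat -> Omega -> R) :
  0 < sigma ->
  (* the data are generated by the adaptive linear Gaussian sampling procedure *)
  (forall j, measurable_fun setT (X j)) ->
  (forall j, measurable_fun setT (Y j)) ->
  (forall n (A : set (hist R p n.+1)), measurable A ->
     P (history X Y n.+1 @^-1` A) =
     (\int[P]_w \int[Lambda n (history X Y n w)]_x
        \int[normal_prob (((col_of x)^T *m beta0) ord0 ord0) sigma]_y
           (\1_A (rcons_tuple (history X Y n w) (x, y)) : R)%:E)%E) ->
  (* prior: a continuous probability density with pi(beta0) > 0 *)
  (forall b, 0 <= prior b) ->
  continuous prior ->
  lebRp (fun b => (prior b)%:E) = 1%E ->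
  0 < prior beta0 ->
  (* (i) lambda_min ->p oo and log lambda_max = o_p(lambda_min) *)
  (forall M : R, (fun n => P [set w | lambda_min (gram (history X Y n w)) <= M])
                   @ \oo --> 0%E) ->
  (forall eps : R, 0 < eps ->
     (fun n => P [set w | eps * `| lambda_min (gram (history X Y n w)) |
                          < `| ln (lambda_max (gram (history X Y n w))) |])
       @ \oo --> 0%E) ->
  (* conclusion: TV(posterior, N(betahat, sigma^2 (X^T X)^{-1})) ->p 0
     (histories with singular X^T X are counted as exceptional) *)
  forall eps : R, 0 < eps ->
    (fun n => P [set w | ~~ (gram (history X Y n w) \in unitmx) \/
        (eps%:E < TV (posterior prior sigma (history X Y n w))
                     (gauss_density (betahat (history X Y n w)) sigma
                                    (gram (history X Y n w))))%E])
      @ \oo --> 0%E.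
Proof.
move=> s0 mX mY gen prior0 cprior prior1 prior_pos lmin_oo lmax_o eps eps0.
have mH n : measurable_fun setT (history X Y n) by exact: measurable_history.
(* In dimension 0 the event lambda_min <= 0 has probability 1 for every n, which contradicts (i)
   with M = 0. *)
have p0 : (0 < p)%N.
  case: p Lambda prior beta0 X Y mX mY gen prior0 cprior prior1 prior_pos
    lmin_oo lmax_o mH => [|//].
  move=> {}Lambda {}prior {}beta0 {}X {}Y _ _ _ _ _ _ _ lmin_oo _ _.
  have := lmin_oo 0.
  rewrite (_ : (fun n => _) = cst 1%E); last first.
    apply/funext => n; rewrite -[RHS](probability_setT P); congr (P _).
    by apply/seteqP; split => // w _ /=; rewrite lambda_min_dim0.
  move=> /cvg_unique /(_ (cvg_cst _)) => /(_ (@ereal_hausdorff R)) /eqP.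
  by rewrite eq_sym onee_eq0.
pose Bad n := [set w | ~~ (gram (history X Y n w) \in unitmx) \/
  (eps%:E < TV (posterior prior sigma (history X Y n w))
               (gauss_density (betahat (history X Y n w)) sigma
                              (gram (history X Y n w))))%E].
change ((fun n => P (Bad n)) @ \oo --> 0%E).
have mTV n : measurable_fun setT (fun w => TV_formula sigma prior (history X Y n w)).
  exact: measurable_TV_formula.
have mlmin n : measurable_fun setT (fun w => lambda_min (gram (history X Y n w))).
  exact: measurable_lambda_min.
have mlmax n : measurable_fun setT (fun w => lambda_max (gram (history X Y n w))).
  exact: measurable_lambda_max.
have mBad n : measurable (Bad n).
  (* Where the Gram matrix is invertible, [TV_formula] is the distance; all other histories lie in
     the first set. *)
  rewrite (_ : Bad n = [set w | lambda_min (gram (history X Y n w)) <= 0] `|`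
      [set w | (eps%:E < TV_formula sigma prior (history X Y n w))%E]).
    apply: measurableU; first exact: measurable_le_set.
    rewrite -[X in measurable X]setTI.
    exact: (emeasurable_fun_o_infty measurableT (mTV n)).
  apply/seteqP; split => w; rewrite /Bad /= leNgt lambda_min_gram_gt0 //.
    have [ug|nug _] := boolP (gram (history X Y n w) \in unitmx); last by left.
    by rewrite (TV_formulaE s0 prior0 cprior prior1 ug) => -[//|]; right.
  have [ug|nug _] := boolP (gram (history X Y n w) \in unitmx); last by left.
  by rewrite -(TV_formulaE s0 prior0 cprior prior1 ug) => -[//|]; right.
apply/cvge0P => [n|e e0]; first exact: measure_ge0.
(* Each of the three exceptional events gets a third of e. The level of the mixture event is fixed
   first, because [M] and [e1] depend on it. *)
have d0 : 0 < e / 3 by rewrite divr_gt0.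
have [M [e1 [M0 e10 good]]] :=
  TV_small_on_good_event p0 s0 prior0 cprior prior1 prior_pos eps0 d0.
have /cvge0P := lmin_oo M => /(_ (fun n => measure_ge0 P _) _ d0) near1.
have /cvge0P := lmax_o _ e10 => /(_ (fun n => measure_ge0 P _) _ d0) near2.
apply: filterS2 near1 near2 => n P1 P2.
set E1 := [set w | _] in P1; set E2 := [set w | _] in P2.
have [mE3 P3] := mixture_markov s0 (mH n) d0
  (mixture_mean s0 (mH n) (fun b => likelihood_ratio_mean s0 mX mY gen n b)).
set E3 := [set w | _] in mE3 P3.
have mE1 : measurable E1 by exact: measurable_le_set.
have mE2 : measurable E2.
  apply: measurable_lt_set.
    by apply: measurable_funM => //; exact: measurableT_comp.
  by apply: measurableT_comp => //; exact: measurableT_comp.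
have sub : Bad n `<=` E1 `|` E2 `|` E3.
  move=> w Bw; apply: contrapT => nE.
  have nE1 : M < lambda_min (gram (history X Y n w)).
    by rewrite ltNge; apply/negP => h; apply: nE; left; left.
  have nE2 : `|ln (lambda_max (gram (history X Y n w)))| <=
      e1 * `|lambda_min (gram (history X Y n w))|.
    by rewrite leNgt; apply/negP => h; apply: nE; left; right.
  have nE3 : (mixture sigma beta0 (history X Y n w) <= (e / 3)^-1%:E)%E.
    by rewrite leNgt; apply/negP => h; apply: nE; right.
  case: Bw => [/negP|]; first by rewrite -lambda_min_gram_gt0 // (le_lt_trans M0).
  by rewrite ltNge good.
have m12 : measurable (E1 `|` E2) by exact: measurableU.
apply: (@le_trans _ _ (P (E1 `|` E2 `|` E3))).
  by apply: le_measure; rewrite ?inE //; exact: measurableU.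
apply: (le_trans (measureU2 _ m12 mE3)).
apply: (@le_trans _ _ ((e / 3)%:E + (e / 3)%:E + (e / 3)%:E)%E).
  apply: leeD => //; apply: (le_trans (measureU2 _ mE1 mE2)); exact: leeD.
by rewrite -!EFinD lee_fin; lra.
Qed.
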